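(* Let $n\geq 2$ and let $b_1,\ldots,b_n$ be integers with $b_i\neq 0$ for all $i\in\{1,\ldots,n\}$. Let the one-dimensional torus $G=k^\times$ act on the $n$-th Weyl algebra $A_n=k[Q_1,\ldots,Q_n,P_1,\ldots,P_n]$ by $g\cdot Q_i=g^{b_i}Q_i$, $g\cdot P_i=g^{-b_i}P_i$. Then $A_n^G$ is a Noetherian FCR-algebra of Gelfand–Kirillov dimension $2n-1$. In particular, there are Noetherian FCR-algebras of every odd Gelfand–Kirillov dimension $\geq 3$.
   Context: $k$ is an algebraically closed field of characteristic $0$. $A_n$ is the ring of differential operators on $k^n$, with $Q_i$ the coordinate functions and $P_i=\partial/\partial Q_i$; $A_n^G$ is the ring of $G$-invariants. A $k$-algebra $R$ is an FCR-algebra if (i) $R$ has enough finite dimensional modules, i.e. the intersection of the annihilators of all finite dimensional $R$-modules is zero, and (ii) every finite dimensional $R$-module is completely reducible. *)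

(* Defs.v *)
From HB Require Import structures.
From mathcomp Require Import all_boot all_order all_algebra.
From mathcomp Require Import boolp classical_sets reals ereal sequences exp.
(* The notations of mpoly.v cannot be loaded together with those of
   MathComp-Analysis. *)
From mathcomp Require Import -(notations) mpoly.

Set Implicit Arguments.
Unset Strict Implicit.
Unset Printing Implicit Defensive.

Import Order.TTheory GRing.Theory Num.Theory.

Local Open Scope ring_scope.

(** * Noetherian algebras *)

(* Subsets are given by predicates [{pred M}]; classically, these are all the
   subsets of [M]. *)

Definition noetherian_module (S : nzRingType) (M : lmodType S) : Prop :=
  forall N : nat -> {pred M},
    (forall i, GRing.submod_closed (N i)) ->
    (forall i, {subset N i <= N i.+1}) ->
  exists m, forall i, (m <= i)%N -> N i =i N m.

(* [S^o] is [S] as a left module over itself, whose submodules are the left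
   ideals; the left ideals of the converse ring [S^c] are the right ideals of
   [S]. *)
Definition noetherian (S : nzRingType) : Prop :=
  noetherian_module S^o /\ noetherian_module (S^c)^o.

(** * FCR-algebras *)

Section FCR.
Variables (k : fieldType) (A : algType k).

(* The action of [c : k] on an [A]-module is that of [c%:A = c *: 1]. *)
Definition finite_dimensional (M : lmodType A) : Prop :=
  exists (d : nat) (e : 'I_d -> M), forall x : M,
    exists c : 'I_d -> k, x = \sum_(i < d) (c i)%:A *: e i.

Definition completely_reducible (M : lmodType A) : Prop :=
  forall N : {pred M}, GRing.submod_closed N ->
  exists N' : {pred M},
    [/\ GRing.submod_closed N',
        forall x, x \in N -> x \in N' -> x = 0
      & forall x, exists y z, [/\ y \in N, z \in N' & x = y + z]].

Definition annihilates (a : A) (M : lmodType A) : Prop :=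
  forall x : M, a *: x = 0.

Definition enough_finite_dimensional : Prop :=
  forall a : A,
    (forall M : lmodType A, finite_dimensional M -> annihilates a M) -> a = 0.

Definition FCR_algebra : Prop :=
  enough_finite_dimensional /\
  (forall M : lmodType A, finite_dimensional M -> completely_reducible M).

End FCR.

(** * Gelfand-Kirillov dimension *)

Section GKdim.
Variable k : fieldType.

(* The largest size of a linearly independent subfamily of [s], which is the
   dimension of the subspace spanned by [s]. *)
Definition dim_span (V : lmodType k) (s : seq V) : nat :=
  \max_(I : {set 'I_(size s)} |
          `[< forall c : 'I_(size s) -> k,
                \sum_(i in I) c i *: s`_i = 0 ->
                forall i, i \in I -> c i = 0 >]) #|I|.

Fixpoint products (A : algType k) (s : seq A) (m : nat) : seq A :=
  if m is m'.+1 then [seq x * y | x <- s, y <- products s m'] else [:: 1].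

(* If [s] spans [V], this list spans [k + V + V^2 + ... + V^m]. *)
Definition products_upto (A : algType k) (s : seq A) (m : nat) : seq A :=
  flatten [seq products s j | j <- iota 0 m.+1].

(* The values at [m = 0, 1], where the logarithm in the denominator is [0],
   do not affect the limit superior. *)
Definition GKdim (R : realType) (A : algType k) : \bar R :=
  ereal_sup [set limn_esup (fun m : nat =>
                   (ln (dim_span (products_upto s m))%:R / ln m%:R : R)%:E)
            | s in [set: seq A]].

End GKdim.

(** * Algebras of invariants *)

Section Invariants.
Variables (k : fieldType) (G : Type) (A : algType k).
Variable act : G -> {lrmorphism A -> A}.

Definition is_invariant : {pred A} := fun x => `[< forall g, act g x = x >].

Lemma is_invariantP x : reflect (forall g, act g x = x) (x \in is_invariant).
Proof. exact: asboolP. Qed.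

Lemma is_invariant_closed : GRing.subsemialg_closed is_invariant.
Proof.
split.
- by apply/is_invariantP => g; rewrite rmorph1.
- split.
  + by apply/is_invariantP => g; rewrite rmorph0.
  + move=> x y /is_invariantP xi /is_invariantP yi.
    by apply/is_invariantP => g; rewrite rmorphD /= xi yi.
- move=> c x /is_invariantP xi.
  by apply/is_invariantP => g; rewrite linearZ /= xi.
- move=> x y /is_invariantP xi /is_invariantP yi.
  by apply/is_invariantP => g; rewrite rmorphM /= xi yi.
Qed.

Definition invariants : Type := {x : A | is_invariant x}.

HB.instance Definition _ := SubChoice.on invariants.
HB.instance Definition _ :=
  GRing.SubChoice_isSubAlgebra.Build k A is_invariant invariants
    is_invariant_closed.

End Invariants.

(** * The Weyl algebra *)

Section Weyl.
Variables (k : fieldType) (n : nat).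

Local Notation pol := (mpoly n k).

(* The algebra of all [k]-linear endomorphisms of [k[Q_1, ..., Q_n]], with
   composition as product. *)
Definition polyend : Type := {linear pol -> pol}.

Definition polyend_fun (f : polyend) : {linear pol -> pol} := f.
Coercion polyend_fun : polyend >-> GRing.Linear.type.

Definition Polyend (f : {linear pol -> pol}) : polyend := f.

Lemma polyendP (f g : polyend) : f =1 g -> f = g.
Proof.
move: f g => [f cf] [g cg] /= /funext fg.
move: cf cg; rewrite /= in fg; rewrite fg => cf cg; congr GRing.Linear.Pack.
move: cf cg => [[a1] [a2]] [[b1] [b2]].
by rewrite (Prop_irrelevance a1 b1) (Prop_irrelevance a2 b2).
Qed.

Lemma polyend_ext (f g : polyend) :
  (forall m, f (mpolyX k m) = g (mpolyX k m)) -> f = g.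
Proof.
move=> fg; apply: polyendP => p; rewrite [p]mpolyE !linear_sum.
by apply: eq_bigr => m _; rewrite !linearZ /= fg.
Qed.

HB.instance Definition _ := gen_eqMixin polyend.
HB.instance Definition _ := gen_choiceMixin polyend.

Definition pe_zero : polyend := Polyend \0.
Definition pe_opp (f : polyend) : polyend := Polyend (\- f).
Definition pe_add (f g : polyend) : polyend := Polyend (f \+ g).
Definition pe_one : polyend := Polyend idfun.
Definition pe_mul (f g : polyend) : polyend := Polyend (f \o g).
Definition pe_scale (c : k) (f : polyend) : polyend := Polyend (c \*: f).

Fact pe_addA : associative pe_add.
Proof. by move=> f g h; apply: polyendP => p /=; rewrite addrA. Qed.
Fact pe_addC : commutative pe_add.
Proof. by move=> f g; apply: polyendP => p /=; rewrite addrC. Qed.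
Fact pe_add0 : left_id pe_zero pe_add.
Proof. by move=> f; apply: polyendP => p /=; rewrite add0r. Qed.
Fact pe_addN : left_inverse pe_zero pe_opp pe_add.
Proof. by move=> f; apply: polyendP => p /=; rewrite addNr. Qed.
Fact pe_mulA : associative pe_mul.
Proof. by move=> f g h; apply: polyendP. Qed.
Fact pe_mul1 : left_id pe_one pe_mul.
Proof. by move=> f; apply: polyendP. Qed.
Fact pe_mulr1 : right_id pe_one pe_mul.
Proof. by move=> f; apply: polyendP. Qed.
Fact pe_mulDl : left_distributive pe_mul pe_add.
Proof. by move=> f g h; apply: polyendP. Qed.
Fact pe_mulDr : right_distributive pe_mul pe_add.
Proof. by move=> f g h; apply: polyendP => p /=; rewrite linearD. Qed.
Fact pe_one_neq0 : pe_one != pe_zero.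
Proof.
apply/eqP => /(congr1 (fun f : polyend => f 1)) /= /eqP.
by rewrite oner_eq0.
Qed.

HB.instance Definition _ := GRing.isNzRing.Build polyend
  pe_addA pe_addC pe_add0 pe_addN pe_mulA pe_mul1 pe_mulr1
  pe_mulDl pe_mulDr pe_one_neq0.

Fact pe_scaleA a b f : pe_scale a (pe_scale b f) = pe_scale (a * b) f.
Proof. by apply: polyendP => p /=; rewrite scalerA. Qed.
Fact pe_scale1 : left_id 1 pe_scale.
Proof. by move=> f; apply: polyendP => p /=; rewrite scale1r. Qed.
Fact pe_scaleDr : right_distributive pe_scale +%R.
Proof. by move=> a f g; apply: polyendP => p /=; rewrite scalerDr. Qed.
Fact pe_scaleDl f : {morph pe_scale^~ f : a b / a + b}.
Proof. by move=> a b; apply: polyendP => p /=; rewrite scalerDl. Qed.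

HB.instance Definition _ := GRing.Zmodule_isLmodule.Build k polyend
  pe_scaleA pe_scale1 pe_scaleDr pe_scaleDl.

Fact pe_scaleAl (a : k) (f g : polyend) : a *: (f * g) = (a *: f) * g.
Proof. exact: polyendP. Qed.
Fact pe_scaleAr (a : k) (f g : polyend) : a *: (f * g) = f * (a *: g).
Proof. by apply: polyendP => p /=; rewrite linearZ. Qed.

HB.instance Definition _ := GRing.Lmodule_isLalgebra.Build k polyend pe_scaleAl.
HB.instance Definition _ := GRing.Lalgebra_isAlgebra.Build k polyend pe_scaleAr.

Lemma polyendME (f g : polyend) p : (f * g) p = f (g p).
Proof. by []. Qed.
Lemma polyendZE c (f : polyend) p : (c *: f) p = c *: f p.
Proof. by []. Qed.

Local Notation X i := (mpolyX k (mnm1 i)).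

Definition opQ (i : 'I_n) : polyend := Polyend (X i \*o idfun).
Definition opP (i : 'I_n) : polyend := Polyend (mderiv i).

(* The subalgebra generated by the [Q_i] and the [P_i]. *)
Definition is_weyl : {pred polyend} := fun D =>
  `[< forall S : {pred polyend}, GRing.subalg_closed S ->
        (forall i, opQ i \in S) -> (forall i, opP i \in S) -> D \in S >].

Lemma is_weylP D :
  reflect (forall S : {pred polyend}, GRing.subalg_closed S ->
             (forall i, opQ i \in S) -> (forall i, opP i \in S) -> D \in S)
          (D \in is_weyl).
Proof. exact: asboolP. Qed.

Lemma is_weyl_closed : GRing.subalg_closed is_weyl.
Proof.
split.
- by apply/is_weylP => S [].
- move=> c D E /is_weylP Dw /is_weylP Ew; apply/is_weylP => S Sc SQ SP.
  by case: (Sc) => _ SL _; apply: SL; [apply: Dw | apply: Ew].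
- move=> D E /is_weylP Dw /is_weylP Ew; apply/is_weylP => S Sc SQ SP.
  by case: (Sc) => _ _ SM; apply: SM; [apply: Dw | apply: Ew].
Qed.

Lemma opQ_weyl i : opQ i \in is_weyl.
Proof. by apply/is_weylP => S _ + _; apply. Qed.

Lemma opP_weyl i : opP i \in is_weyl.
Proof. by apply/is_weylP => S _ _; apply. Qed.

Definition weyl : Type := {D : polyend | is_weyl D}.

HB.instance Definition _ := SubChoice.on weyl.
HB.instance Definition _ :=
  GRing.SubChoice_isSubAlgebra.Build k polyend is_weyl weyl
    (GRing.subalg_closed_semi is_weyl_closed).

Definition weylQ (i : 'I_n) : weyl := exist _ (opQ i) (opQ_weyl i).
Definition weylP (i : 'I_n) : weyl := exist _ (opP i) (opP_weyl i).

End Weyl.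

(** * The torus and its action *)

Section Torus.
Variable k : fieldType.

Definition torus : Type := {g : k | g != 0}.

HB.instance Definition _ := SubChoice.on torus.

Lemma torus_neq0 (g : torus) : val g != 0.
Proof. by case: g. Qed.

Definition torus1 : torus := exist _ 1 (oner_neq0 k).
Definition torusV (g : torus) : torus :=
  exist _ (val g)^-1 (invr_neq0 (torus_neq0 g)).
Definition torusM (g h : torus) : torus :=
  exist _ (val g * val h) (mulf_neq0 (torus_neq0 g) (torus_neq0 h)).

Fact torusA : associative torusM.
Proof. by move=> g h i; apply: val_inj; rewrite /= mulrA. Qed.
Fact torus1M : left_id torus1 torusM.
Proof. by move=> g; apply: val_inj; rewrite /= mul1r. Qed.
Fact torusM1 : right_id torus1 torusM.
Proof. by move=> g; apply: val_inj; rewrite /= mulr1. Qed.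
Fact torusVM : left_inverse torus1 torusV torusM.
Proof. by move=> g; apply: val_inj; rewrite /= mulVf ?torus_neq0. Qed.
Fact torusMV : right_inverse torus1 torusV torusM.
Proof. by move=> g; apply: val_inj; rewrite /= mulfV ?torus_neq0. Qed.

HB.instance Definition _ :=
  isGroup.Build torus torusA torus1M torusM1 torusVM torusMV.

End Torus.

Section TorusAction.
Variables (k : fieldType) (n : nat) (b : 'I_n -> int).

Local Notation pol := (mpoly n k).
Local Notation X i := (mpolyX k (mnm1 i)).

(* The substitution [Q_i |-> g ^ (b i) Q_i] of [k[Q_1, ..., Q_n]]. *)
Definition qsubst (g : torus k) : {lrmorphism pol -> pol} :=
  comp_mpoly [tuple (val g ^ b i) *: X i | i < n].

Definition opsubst (g : torus k) : polyend k n := Polyend (qsubst g).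

Lemma qsubstXU g i : qsubst g (X i) = (val g ^ b i) *: X i.
Proof. by rewrite /= comp_mpolyXU -tnth_nth tnth_mktuple. Qed.

Definition weight (g : torus k) (m : multinom n) : k :=
  \prod_(i < n) (val g ^ b i) ^+ m i.

Lemma qsubstX g (m : multinom n) : qsubst g (mpolyX k m) = weight g m *: mpolyX k m.
Proof.
rewrite /= comp_mpolyX [Z in _ = _ *: Z]mpolyXE_id -scaler_prod.
by apply: eq_bigr => i _; rewrite tnth_mktuple exprZn.
Qed.

Lemma opsubstX g m : opsubst g (mpolyX k m) = weight g m *: mpolyX k m.
Proof. exact: qsubstX. Qed.

Lemma opsubst1 : opsubst 1%g = 1.
Proof.
apply: polyend_ext => m; rewrite opsubstX /weight big1 ?scale1r // => i _.
by rewrite exp1rz expr1n.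
Qed.

Lemma opsubstM g h : opsubst (g * h)%g = opsubst g * opsubst h.
Proof.
apply: polyend_ext => m; rewrite polyendME !opsubstX linearZ /= opsubstX scalerA.
rewrite -big_split /=; congr (_ *: _).
by apply: eq_bigr => i _; rewrite expfzMl exprMn mulrC.
Qed.

Lemma opsubstVK g : opsubst (g^-1)%g * opsubst g = 1.
Proof. by rewrite -opsubstM mulVg opsubst1. Qed.

Lemma opsubstKV g : opsubst g * opsubst (g^-1)%g = 1.
Proof. by rewrite -opsubstM mulgV opsubst1. Qed.

(* The induced action on operators, by conjugation. *)
Definition conjop (g : torus k) (D : polyend k n) : polyend k n :=
  opsubst g * D * opsubst (g^-1)%g.

Lemma conjopM g D E : conjop g (D * E) = conjop g D * conjop g E.
Proof.
rewrite /conjop -!mulrA; congr (_ * (_ * _)).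
by rewrite !mulrA opsubstVK mul1r.
Qed.

Lemma conjop1 g : conjop g 1 = 1.
Proof. by rewrite /conjop mulr1 opsubstKV. Qed.

Lemma conjop_linear g : linear (conjop g).
Proof.
by move=> c D E; rewrite /conjop mulrDr mulrDl -scalerAr -scalerAl.
Qed.

Lemma conjop_eq g D E : opsubst g * D = E * opsubst g -> conjop g D = E.
Proof. by move=> e; rewrite /conjop e -mulrA opsubstKV mulr1. Qed.

Lemma conjopQ g i : conjop g (opQ k i) = (val g ^ b i) *: opQ k i.
Proof.
apply: conjop_eq; apply: polyendP => p.
rewrite polyendME -[LHS]/(qsubst g (X i * p)) rmorphM /= -/(qsubst g) qsubstXU.
by rewrite -scalerAl.
Qed.

Lemma conjopP g i : conjop g (opP k i) = (val g ^ (- b i)) *: opP k i.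
Proof.
apply: conjop_eq; apply: polyend_ext => m.
rewrite -scalerAl polyendZE polyendME [in RHS]polyendME opsubstX linearZ /=.
rewrite -[opP k i _]/(mderiv i _) mderivX linearZ /= opsubstX !scalerA.
case: (posnP (m i)) => [->|mi]; first by rewrite !(mulr0, mul0r).
congr (_ *: _); rewrite mulrC [RHS]mulrA; congr (_ * _).
rewrite /weight (bigD1 i) //= [in RHS](bigD1 i) //= mulrA; congr (_ * _).
  rewrite mnmBE mnm1E eqxx subn1 -[in RHS](prednK mi) exprS mulrA.
  by rewrite -expfzDr ?torus_neq0 // addNr mul1r.
by apply: eq_bigr => j /negPf ji; rewrite mnmBE mnm1E eq_sym ji subn0.
Qed.

Lemma conjop_weyl g D : D \in @is_weyl k n -> conjop g D \in @is_weyl k n.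
Proof.
move/is_weylP => Dw; apply/is_weylP => S Sc SQ SP; have [S1 SL SM] := Sc.
have SZ c E : E \in S -> c *: E \in S.
  by move=> ES; case: (GRing.subalg_closed_semi Sc) => _ _ + _; apply.
apply: (Dw [pred E | conjop g E \in S]) => [|i|i].
- split=> [|c E F|E F]; rewrite !inE ?conjop1 ?conjop_linear ?conjopM //.
  + exact: SL.
  + exact: SM.
- by rewrite inE conjopQ SZ.
- by rewrite inE conjopP SZ.
Qed.

Definition torus_fun (g : torus k) (D : weyl k n) : weyl k n :=
  exist _ (conjop g (val D)) (conjop_weyl g (valP D)).

Fact torus_fun_linear g : linear (torus_fun g).
Proof. by move=> c D E; apply: val_inj; rewrite /= conjop_linear. Qed.

Fact torus_fun_multiplicative g : monoid_morphism (torus_fun g).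
Proof. by split=> [|D E]; apply: val_inj; rewrite /= ?conjop1 ?conjopM. Qed.

HB.instance Definition _ g :=
  GRing.isLinear.Build k (weyl k n) (weyl k n) _ (torus_fun g)
    (torus_fun_linear g).
HB.instance Definition _ g :=
  GRing.isMonoidMorphism.Build (weyl k n) (weyl k n) (torus_fun g)
    (torus_fun_multiplicative g).

Definition torus_act (g : torus k) : {lrmorphism weyl k n -> weyl k n} :=
  torus_fun g.

Lemma torus_actQ g i : torus_act g (weylQ k i) = (val g ^ b i) *: weylQ k i.
Proof. by apply: val_inj; rewrite /= conjopQ. Qed.

Lemma torus_actP g i : torus_act g (weylP k i) = (val g ^ (- b i)) *: weylP k i.
Proof. by apply: val_inj; rewrite /= conjopP. Qed.

Lemma torus_act1 D : torus_act 1%g D = D.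
Proof.
by apply: val_inj; rewrite /= /conjop invg1 opsubst1 mul1r mulr1.
Qed.

Lemma torus_actM g h D : torus_act (g * h)%g D = torus_act g (torus_act h D).
Proof.
by apply: val_inj; rewrite /= /conjop invgM !opsubstM !mulrA.
Qed.

End TorusAction.

Arguments torus_act k {n} b g.

(* Main.v *)
(* A partial Fourier transform makes all the weights positive: with w_i = |b_i|,
   the algebra of invariants A becomes the span of the balanced monomials
   Q^a P^b, those with sum_i w_i a_i = sum_i w_i b_i.

   Noetherian: ordering the monomials by degree, leading exponents add up, and
   Dickson's lemma applies to the leading exponents of one-sided ideals.

   Enough finite dimensional modules: the weight spaces of k[Q_1, ..., Q_n] are
   finite dimensional and A acts faithfully on their sum.

   Complete reducibility: on a finite dimensional module, Q_i^(w_j) P_j^(w_i)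
   shifts the eigenvalues of theta_i = Q_i P_i, hence is nilpotent. Multiplying
   one of its powers by the transposed monomial gives a polynomial relation
   between theta_i and theta_j; as n >= 2, these relations force every theta_i to
   be diagonalisable with integer eigenvalues, and in each joint eigenvector the
   eigenvalues are all nonnegative or all negative. The central element
   sum_i w_i theta_i tells the two cases apart. Hence a nonzero balanced monomial
   carrying an eigenvector to another one is inverted up to a nonzero scalar by
   its transpose, so every joint eigenvector generates a simple module.

   Gelfand-Kirillov dimension: a balanced exponent is determined by 2n - 1 of its
   coordinates, and there are 2n - 1 linearly independent balanced exponents. *)
Require Import Defs.
From HB Require Import structures.
From mathcomp Require Import all_boot all_order all_algebra.
From mathcomp Require Import boolp classical_sets reals ereal.
From mathcomp Require Import sequences exp zify.
From mathcomp Require Import -(notations) mpoly topology.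

Set Implicit Arguments.
Unset Strict Implicit.
Unset Printing Implicit Defensive.

Import Order.TTheory GRing.Theory Num.Theory.

Local Open Scope ring_scope.

(** * Normal ordering *)

Section Multinomials.
Variable n : nat.
Implicit Types (m : multinom n) (mm : multinom (n + n)).

Lemma mnm_ind (P : multinom n -> Prop) :
  P (@mnm0 n) -> (forall i m, P m -> P (mnm_add (mnm1 i) m)) -> forall m, P m.
Proof.
move=> P0 PS m; have [d] := ubnP (mdeg m); elim: d m => // d IH m.
have [->//|m0] := eqVneq m (@mnm0 n); rewrite ltnS => md.
have /existsP[i mi]: [exists i, m i != 0%N].
  apply: contraNT m0 => /existsPn m0; apply/eqP/mnmP => i.
  by rewrite mnm0E; apply/eqP; have := m0 i; rewrite negbK.
have lei : lem (mnm1 i) m by rewrite lep1mP.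
rewrite -(submK lei) addmC; apply/PS/IH; apply: leq_trans md.
by rewrite -[in X in (_ < X)%N](submK lei) mdegD mdeg1 addn1.
Qed.

Lemma split_lshift (i : 'I_n) : split (lshift n i) = inl i.
Proof. exact: (unsplitK (inl i)). Qed.
Lemma split_rshift (i : 'I_n) : split (rshift n i) = inr i.
Proof. exact: (unsplitK (inr i)). Qed.

Definition mnml mm : multinom n := Multinom [tuple mm (lshift n i) | i < n].
Definition mnmr mm : multinom n := Multinom [tuple mm (rshift n i) | i < n].
Definition mnmx (a b : multinom n) : multinom (n + n) :=
  Multinom [tuple match split i with inl j => a j | inr j => b j end | i < n + n].

Lemma mnmlE mm i : mnml mm i = mm (lshift n i). Proof. exact: mnmE. Qed.
Lemma mnmrE mm i : mnmr mm i = mm (rshift n i). Proof. exact: mnmE. Qed.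

Lemma mnmx_lshift a b i : mnmx a b (lshift n i) = a i.
Proof. by rewrite mnmE split_lshift. Qed.
Lemma mnmx_rshift a b i : mnmx a b (rshift n i) = b i.
Proof. by rewrite mnmE split_rshift. Qed.

Lemma mnmxl a b : mnml (mnmx a b) = a.
Proof. by apply/mnmP => i; rewrite mnmlE mnmx_lshift. Qed.
Lemma mnmxr a b : mnmr (mnmx a b) = b.
Proof. by apply/mnmP => i; rewrite mnmrE mnmx_rshift. Qed.

Lemma mnmxK mm : mnmx (mnml mm) (mnmr mm) = mm.
Proof.
apply/mnmP => i; rewrite -(splitK i); case: (split i) => j /=.
  by rewrite mnmx_lshift mnmlE.
by rewrite mnmx_rshift mnmrE.
Qed.

Lemma mnmlD mm mm' : mnml (mnm_add mm mm') = mnm_add (mnml mm) (mnml mm').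
Proof. by apply/mnmP => i; rewrite mnmDE !mnmlE mnmDE. Qed.
Lemma mnmrD mm mm' : mnmr (mnm_add mm mm') = mnm_add (mnmr mm) (mnmr mm').
Proof. by apply/mnmP => i; rewrite mnmDE !mnmrE mnmDE. Qed.
Lemma mnmlB mm mm' : mnml (mnm_sub mm mm') = mnm_sub (mnml mm) (mnml mm').
Proof. by apply/mnmP => i; rewrite mnmBE !mnmlE mnmBE. Qed.
Lemma mnmrB mm mm' : mnmr (mnm_sub mm mm') = mnm_sub (mnmr mm) (mnmr mm').
Proof. by apply/mnmP => i; rewrite mnmBE !mnmrE mnmBE. Qed.

Lemma mnml_lshift i : mnml (mnm1 (lshift n i)) = mnm1 i.
Proof. by apply/mnmP => j; rewrite mnmlE !mnm1E eq_lshift. Qed.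
Lemma mnmr_rshift i : mnmr (mnm1 (rshift n i)) = mnm1 i.
Proof. by apply/mnmP => j; rewrite mnmrE !mnm1E eq_rshift. Qed.
Lemma mnmr_lshift i : mnmr (mnm1 (lshift n i)) = @mnm0 n.
Proof. by apply/mnmP => j; rewrite mnmrE mnm1E mnm0E eq_lrshift. Qed.
Lemma mnml_rshift i : mnml (mnm1 (rshift n i)) = @mnm0 n.
Proof. by apply/mnmP => j; rewrite mnmlE mnm1E mnm0E eq_rlshift. Qed.
Lemma mnml0 : mnml (@mnm0 _) = @mnm0 n.
Proof. by apply/mnmP => j; rewrite mnmlE !mnm0E. Qed.
Lemma mnmr0 : mnmr (@mnm0 _) = @mnm0 n.
Proof. by apply/mnmP => j; rewrite mnmrE !mnm0E. Qed.

End Multinomials.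

Lemma mpoly_linear_eq (k : fieldType) n (V : lmodType k) (f g : {linear mpoly n k -> V}) :
  (forall m, f (mpolyX k m) = g (mpolyX k m)) -> f =1 g.
Proof.
move=> fg p; rewrite [p]mpolyE !linear_sum; apply: eq_bigr => m _.
by rewrite !linearZ /= fg.
Qed.

Section NormalOrdering.
Variables (k : fieldType) (n : nat) (B : algType k).

Lemma mmap1D (h : 'I_n -> B) (m m' : multinom n) :
  (forall i j, GRing.comm (h i) (h j)) ->
  mmap1 h (mnm_add m m') = mmap1 h m * mmap1 h m'.
Proof.
move=> hC; rewrite /mmap1; elim: index_enum => [|i s IH]; first by rewrite !big_nil mulr1.
rewrite !big_cons IH mnmDE exprD -!mulrA; congr (_ * _); rewrite !mulrA; congr (_ * _).
by apply: commr_prod => j _; apply: commrX; apply: commr_sym; apply: commrX.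
Qed.

(* A polynomial in [n + n] variables is read with the variable [lshift n i] as
   [q i] and [rshift n i] as [p i], all the [q]'s standing to the left of the
   [p]'s. *)
Definition nord (q p : 'I_n -> B) (P : mpoly (n + n) k) : B :=
  mmap (in_alg B) (fun i => match split i with inl j => q j | inr j => p j end) P.

Fact nord_is_linear q p : linear (nord q p).
Proof. by move=> c P P'; rewrite /nord mmapD mmapZ /= mulr_algl. Qed.

HB.instance Definition _ q p :=
  GRing.isLinear.Build k (mpoly (n + n) k) B _ (nord q p) (nord_is_linear q p).

Lemma nordX q p m : nord q p (mpolyX k m) = mmap1 q (mnml m) * mmap1 p (mnmr m).
Proof.
rewrite /nord mmapX /mmap1 big_split_ord /=.
congr (_ * _); apply: eq_bigr => i _.
  by rewrite mnmlE split_lshift.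
by rewrite mnmrE split_rshift.
Qed.

Lemma nord1 q p : nord q p 1 = 1.
Proof. by rewrite -mpolyX0 nordX mnml0 mnmr0 !mmap11 mulr1. Qed.

Definition canonical_pair (q p : 'I_n -> B) :=
  [/\ forall i j, GRing.comm (q i) (q j),
      forall i j, GRing.comm (p i) (p j)
    & forall i j, p i * q j = q j * p i + (i == j)%:R].

Variables (q p : 'I_n -> B).
Hypothesis qpC : canonical_pair q p.

Let qC : forall i j, GRing.comm (q i) (q j). Proof. by case: qpC. Qed.
Let pC : forall i j, GRing.comm (p i) (p j). Proof. by case: qpC. Qed.
Let pq : forall i j, p i * q j = q j * p i + (i == j)%:R. Proof. by case: qpC. Qed.

Lemma nord_mulql i P : q i * nord q p P = nord q p (mpolyX k (mnm1 (lshift n i)) * P).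
Proof.
have := @mpoly_linear_eq k _ B ((q i \*o nord q p)%FUN)
   (nord q p \o (mpolyX k (mnm1 (lshift n i)) \*o idfun))%FUN.
apply=> m /=; rewrite -mpolyXD !nordX mnmlD mnmrD mnml_lshift mnmr_lshift add0m.
by rewrite mmap1D // mmap1U mulrA.
Qed.

Lemma comm_p_monomial i a :
  p i * mmap1 q a = mmap1 q a * p i + (a i)%:R *: mmap1 q (mnm_sub a (mnm1 i)).
Proof.
elim/mnm_ind: a => [|j a IH]; first by rewrite mmap11 mnm0E scale0r addr0 mulr1 mul1r.
rewrite mmap1D // mmap1U mulrA pq mulrDl -!mulrA IH mulrDr -addrA; congr (_ + _).
rewrite mnmDE mnm1E eq_sym natrD scalerDl addrC; congr (_ + _).
  have [->|ne] := eqVneq i j; last by rewrite mul0r scale0r.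
  by rewrite mul1r scale1r addmC addmK.
rewrite -scalerAr; case: (posnP (a i)) => [->|ai]; first by rewrite !scale0r.
have le : lem (mnm1 i) a by rewrite lep1mP -lt0n.
congr (_ *: _); rewrite -[q j](mmap1U q) -mmap1D //; congr mmap1.
by rewrite -addmBA.
Qed.

(** By the Leibniz rule, moving [p i] to the right past the [q]'s costs one derivative in the
    variable [lshift n i]. *)
Lemma nord_mulpl i P :
  p i * nord q p P =
  nord q p (mpolyX k (mnm1 (rshift n i)) * P + mderiv (lshift n i) P).
Proof.
have := @mpoly_linear_eq k _ B (p i \*o nord q p)%FUN
   (nord q p \o ((mpolyX k (mnm1 (rshift n i)) \*o idfun) \+ mderiv (lshift n i)))%FUN.
apply=> m /=; rewrite linearD /= mderivX linearZ /= -mpolyXD !nordX.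
rewrite mnmlD mnmrD mnml_rshift mnmr_rshift add0m mnmlB mnmrB mnml_lshift.
rewrite mnmr_lshift subm0 mmap1D // mmap1U [LHS]mulrA comm_p_monomial mulrDl -mnmlE.
by rewrite -scalerAl -!mulrA.
Qed.

End NormalOrdering.

Lemma msize_leP (k : fieldType) n (P : mpoly n k) d :
  reflect (forall m, mcoeff m P != 0 -> (mdeg m < d)%N) (msize P <= d)%N.
Proof.
apply: (iffP idP) => [Pd m|H].
  by rewrite -mcoeff_msupp => /msize_mdeg_lt /leq_trans; apply.
rewrite msizeE; apply/bigmax_leqP_seq => m mP _; apply: H.
by rewrite -mcoeff_msupp.
Qed.

Lemma msize_mderiv_le (k : fieldType) n (P : mpoly n k) i d :
  (msize P <= d.+1)%N -> (msize (mderiv i P) <= d)%N.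
Proof.
move/msize_leP => Pd; apply/msize_leP => m; rewrite mcoeff_deriv => H.
suff /Pd : mcoeff (mnm_add m (mnm1 i)) P != 0 by rewrite mdegD mdeg1 addn1.
by apply: contraNneq H => ->; rewrite mul0rn.
Qed.

Lemma msizeD_leq (k : fieldType) n (P Q : mpoly n k) d :
  (msize P <= d)%N -> (msize Q <= d)%N -> (msize (P + Q) <= d)%N.
Proof. by move=> Pd Qd; apply: leq_trans (msizeD_le _ _) _; rewrite geq_max Pd. Qed.

Lemma msizeM_leq (k : fieldType) n (P Q : mpoly n k) a b :
  (msize P <= a.+1)%N -> (msize Q <= b)%N -> (msize (P * Q) <= a + b)%N.
Proof.
have [->|P0] := eqVneq P 0; first by rewrite mul0r msize0.
have [->|Q0] := eqVneq Q 0; first by rewrite mulr0 msize0.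
move=> Pa Qb; rewrite msizeM //.
by have := leq_add Pa Qb; rewrite addSn; case: (_ + _)%N.
Qed.

(** * Products of normally ordered polynomials *)

Section StarProduct.
Variables (k : fieldType) (n : nat).

Lemma monomial_q_nord (B : algType k) (q p : 'I_n -> B) a P :
  canonical_pair q p ->
  mmap1 q a * nord q p P = nord q p (mpolyX k (mnmx a (@mnm0 n)) * P).
Proof.
move=> qpC; have [qC pC _] := qpC; elim/mnm_ind: a P => [|i a IH] P.
  rewrite mmap11 mul1r; have -> : mnmx (@mnm0 n) (@mnm0 n) = @mnm0 (n + n).
    by rewrite -[RHS]mnmxK mnml0 mnmr0.
  by rewrite mpolyX0 mul1r.
rewrite mmap1D // mmap1U -mulrA IH nord_mulql // mulrA -mpolyXD.
congr (nord _ _ (mpolyX _ _ * _)).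
by rewrite -[LHS]mnmxK mnmlD mnmrD mnmxl mnmxr mnml_lshift mnmr_lshift add0m.
Qed.

Lemma monomial_p_nord b P s : (msize P <= s.+1)%N ->
  exists2 R, (msize R <= mdeg b + s)%N &
    forall (B : algType k) (q p : 'I_n -> B), canonical_pair q p ->
    mmap1 p b * nord q p P = nord q p (mpolyX k (mnmx (@mnm0 n) b) * P + R).
Proof.
move=> Ps; elim/mnm_ind: b => [|i b [R Rs IH]].
  exists 0 => [|B q p qpC]; first by rewrite msize0.
  rewrite mmap11 mul1r addr0; have -> : mnmx (@mnm0 n) (@mnm0 n) = @mnm0 (n + n).
    by rewrite -[RHS]mnmxK mnml0 mnmr0.
  by rewrite mpolyX0 mul1r.
set Y := mpolyX k (mnm1 (rshift n i)); pose T := mpolyX k (mnmx (@mnm0 n) b) * P + R.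
have Ts : (msize T <= (mdeg b + s).+1)%N.
  apply: msizeD_leq; last exact: leqW.
  rewrite -addnS; apply: msizeM_leq => //; rewrite msizeX ltnS !mdegE big_split_ord /=.
  rewrite big1 ?add0n => [|j _]; last by rewrite mnmx_lshift mnm0E.
  by apply: leq_sum => j _; rewrite mnmx_rshift.
exists (Y * R + mderiv (lshift n i) T) => [|B q p qpC].
  rewrite mdegD mdeg1; apply: msizeD_leq.
    by rewrite -addnA; apply: msizeM_leq; rewrite ?msizeX ?mdeg1.
  by apply: leq_trans (msize_mderiv_le _ Ts) _; rewrite -addnA leq_addl.
have [qC pC _] := qpC.
rewrite mmap1D // mmap1U -mulrA IH // nord_mulpl // addrA; congr (nord _ _ (_ + _)).
rewrite mulrDr mulrA -mpolyXD; congr (mpolyX _ _ * _ + _).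
by rewrite -[LHS]mnmxK mnmlD mnmrD mnmxl mnmxr mnml_rshift mnmr_rshift add0m.
Qed.

(** [R] is chosen before [B], so the same correction serves every canonical pair; this is what makes
    [weyl_lrhom] multiplicative. As [msize] exceeds the degree by one, [R] has degree less than
    [a + b], and symbols multiply up to terms of lower degree. *)
Lemma nordM P P' a b : (msize P <= a.+1)%N -> (msize P' <= b.+1)%N ->
  exists2 R, (msize R <= a + b)%N &
    forall (B : algType k) (q p : 'I_n -> B), canonical_pair q p ->
    nord q p P * nord q p P' = nord q p (P * P' + R).
Proof.
move=> Pa P'b; rewrite [P]mpolyE big_seq; apply: (big_ind (fun x => exists2 R, (msize R <= a + b)%N &
    forall (B : algType k) (q p : 'I_n -> B), canonical_pair q p ->
    nord q p x * nord q p P' = nord q p (x * P' + R))) => [|x y [R Rs ER] [S Ss ES]|m mP].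
- by exists 0 => [|B q p qpC]; rewrite ?msize0 // linear0 !mul0r add0r linear0.
- exists (R + S) => [|B q p qpC]; first exact: msizeD_leq.
  by rewrite linearD mulrDl ER // ES // -linearD mulrDl addrACA.
have md : (mdeg m <= a)%N by rewrite -ltnS; apply: leq_trans Pa; exact: msize_mdeg_lt.
have [R Rs ER] := monomial_p_nord (mnmr m) P'b.
set X := mpolyX k (mnmx (mnml m) (@mnm0 n)).
have mE : (mdeg (mnml m) + mdeg (mnmr m) <= a)%N.
  apply: leq_trans md; rewrite !mdegE big_split_ord /=.
  by rewrite leq_add // leq_sum // => j _; rewrite ?mnmlE ?mnmrE.
exists (mcoeff m P *: (X * R)) => [|B q p qpC].
  apply: leq_trans (msizeZ_le _ _) _.
  apply: leq_trans (msizeM_leq (a := mdeg (mnml m)) _ Rs) _.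
    rewrite msizeX ltnS !mdegE big_split_ord /= [X in (_ + X)%N]big1 ?addn0 => [|j _].
      by apply: leq_sum => j _; rewrite mnmx_lshift.
    by rewrite mnmx_rshift mnm0E.
  by rewrite addnA leq_add2r.
rewrite !linearZ /= -!scalerAl -scalerDr linearZ /=; congr (_ *: _).
rewrite nordX -mulrA ER // monomial_q_nord // mulrDr mulrA -mpolyXD.
congr (nord _ _ (mpolyX _ _ * _ + _)).
by rewrite -[RHS]mnmxK -[LHS]mnmxK mnmlD mnmrD !mnmxl !mnmxr addm0 add0m.
Qed.

End StarProduct.

(** * Leading exponents and Noetherian modules *)

Lemma nat_nondecreasing_subseq (g : nat -> nat) :
  exists2 f : nat -> nat, (forall i, (f i < f i.+1)%N) & forall i, (g (f i) <= g (f i.+1))%N.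
Proof.
(* Beyond [i], choose an index where [g] takes its least value. *)
have nxt i : exists j, (i < j)%N /\ forall l, (i < l)%N -> (g j <= g l)%N.
  have ex : exists v, `[< exists2 j, (i < j)%N & g j = v >].
    by exists (g i.+1); apply/asboolP; exists i.+1.
  case: (ex_minnP ex) => v /asboolP[j ij gj] vmin; exists j; split => // l il.
  by rewrite gj; apply: vmin; apply/asboolP; exists l.
(* Starting at [h 0] makes every [f i] a value of [h], hence a minimiser of [g] over a tail that
   contains all later terms. *)
case: (choice nxt) => h hP; pose f i := iter i h (h 0%N).
exists f => i; first by have [] := hP (f i).
have H l : exists x, f l = h x /\ (x < f l)%N.
  by case: l => [|l]; [exists 0%N; case: (hP 0%N) | exists (f l); case: (hP (f l))].
have [x [fx xf]] := H i; rewrite fx; case: (hP x) => _; apply.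
by apply: ltn_trans xf _; case: (hP (f i)).
Qed.

(** Nondecreasing subsequences are extracted one coordinate after another; the first two terms of
    the last one serve. *)
Lemma dickson n (f : nat -> multinom n) : exists i j, (i < j)%N /\ lem (f i) (f j).
Proof.
suff [h hinc hle] : exists2 h : nat -> nat, (forall i, (h i < h i.+1)%N) &
    forall c, c \in enum 'I_n -> forall i, (f (h i) c <= f (h i.+1) c)%N.
  exists (h 0%N), (h 1%N); split => //; apply/forallP => c.
  by apply: hle; rewrite mem_enum.
elim: (enum _) => [|c s [h hinc hle]]; first by exists id.
have [g ginc gle] := nat_nondecreasing_subseq (fun i => f (h i) c).
have hmono a b : (a <= b)%N -> (h a <= h b)%N.
  by move=> ab; apply: (@homo_leq _ h leq) ab => //; [exact: leq_trans | move=> i; exact: ltnW].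
exists (h \o g) => [i|c' /= ].
  apply: leq_trans (hinc (g i)) _; exact: hmono.
rewrite inE => /orP[/eqP->//|c's] i.
apply: (@homo_leq _ (fun j => f (h j) c') leq) (ltnW (ginc i)) => //; first exact: leq_trans.
by move=> j; apply: hle.
Qed.

(* The leading exponents of the submodules of an ascending chain stabilise by
   Dickson's lemma, and submodules [N <= N'] with the same leading exponents are
   equal, by division. *)
Lemma noetherian_module_lead (S : nzRingType) (M : lmodType S) n (ld : M -> multinom n) :
  (forall x y, x != 0 -> y != 0 -> lem (ld x) (ld y) ->
     exists s, y - s *: x = 0 \/ (ld (y - s *: x)%R < ld y)%O) ->
  noetherian_module M.
Proof.
move=> H N Ncl Ninc.
have Nmono i j : (i <= j)%N -> {subset N i <= N j}.
  elim: j => [|j IH]; first by rewrite leqn0 => /eqP->.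
  by rewrite leq_eqVlt ltnS => /predU1P[->//|/IH sub x /sub /Ninc].
have [m mP] : exists m, forall i, (m <= i)%N -> forall x, x \in N i -> x != 0 ->
    exists y, [/\ y \in N m, y != 0 & lem (ld y) (ld x)].
  apply: contrapT => nex.
  (* If no [m] works, iterating this choice gives elements whose leading exponents are divisible by
     no earlier one, against Dickson's lemma. *)
  have step m : exists ix : nat * M, [/\ (m <= ix.1)%N, ix.2 \in N ix.1, ix.2 != 0 &
      forall y, y \in N m -> y != 0 -> ~~ lem (ld y) (ld ix.2)].
    apply: contrapT => nstep; apply: nex; exists m => i mi x xi x0.
    apply: contrapT => ny; apply: nstep; exists (i, x); split => // y ym y0.
    by apply/negP => yx; apply: ny; exists y.
  case: (choice step) => h hP.
  pose g j := iter j (fun m => (h m).1) 0%N.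
  have ginc i j : (i <= j)%N -> (g i <= g j)%N.
    move=> ij; apply: (@homo_leq _ g leq) ij => //; first exact: leq_trans.
    by move=> l; case: (hP (g l)).
  have [i [j [ij]]] := dickson (fun j => ld (h (g j)).2).
  apply/negP; case: (hP (g j)) => _ _ _; apply; case: (hP (g i)) => // _ xi _ _.
  exact: (Nmono _ _ (ginc _ _ ij)).
exists m => i mi x; apply/idP/idP; last exact: Nmono.
move: x; suff H' a : forall x, ld x = a -> x \in N i -> x \in N m by move=> x; apply: H'.
have [N0m Nlm] := Ncl m; have [N0i Nli] := Ncl i.
elim/(@ltmwf n): a => a IH x xa xi; have [->|x0] := eqVneq x 0; first exact: N0m.
have [y [ym y0 yx]] := mP i mi x xi x0.
have [s sP] := H y x y0 x0 yx.
rewrite -(subrK (s *: y) x) addrC; apply: Nlm => //.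
case: sP => [->//|lt]; apply: IH (erefl _) _; first by rewrite -xa.
by rewrite addrC -scaleNr; apply: Nli => //; exact: (Nmono m).
Qed.

(** * The Weyl algebra *)

Lemma pchar0_natf_eq0 (k : fieldType) : [pchar k] =i pred0 ->
  forall j : nat, ((j%:R : k) == 0) = (j == 0%N).
Proof. by move=> ch; exact/pcharf0P. Qed.

Lemma mnm_subnn n (m : multinom n) : mnm_sub m m = @mnm0 n.
Proof. by apply/mnmP => i; rewrite mnmBE subnn mnm0E. Qed.

Section WeylOperators.
Variables (k : fieldType) (n : nat).
Implicit Types (m : multinom n) (mm : multinom (n + n)).

Definition nu : mpoly (n + n) k -> polyend k n := nord (@opQ k n) (@opP k n).
HB.instance Definition _ := GRing.Linear.on nu.

Lemma polyendDE (f g : polyend k n) p : (f + g) p = f p + g p.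
Proof. by []. Qed.

Lemma polyend_sumE I (r : seq I) (P : pred I) (F : I -> polyend k n) p :
  (\sum_(i <- r | P i) F i) p = \sum_(i <- r | P i) F i p.
Proof.
elim: r => [|i r IH]; first by rewrite !big_nil.
by rewrite !big_cons; case: ifP => _ //; rewrite polyendDE IH.
Qed.

Lemma canonical_pair_QP : canonical_pair (@opQ k n) (@opP k n).
Proof.
split=> i j.
- by apply: polyendP => p; rewrite !polyendME /= !mulrA [mpolyX _ _ * mpolyX _ _]mulrC.
- by apply: polyendP => p; rewrite !polyendME /= mderiv_comm.
- apply: polyendP => p; rewrite polyendDE !polyendME.
  rewrite -[opQ k j p]/(mpolyX k (mnm1 j) * p) -[LHS]/(mderiv i _) mderivM addrC.
  congr (_ + _); rewrite mderivX mnm1E eq_sym; case: eqVneq => [->|_].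
    by rewrite scale1r mnm_subnn mpolyX0 mul1r.
  by rewrite scale0r mul0r.
Qed.

Let qC : forall i j, GRing.comm (@opQ k n i) (opQ k j).
Proof. by case: canonical_pair_QP. Qed.
Let pC : forall i j, GRing.comm (@opP k n i) (opP k j).
Proof. by case: canonical_pair_QP. Qed.

Lemma monomial_opQE m p : mmap1 (@opQ k n) m p = mpolyX k m * p.
Proof.
elim/mnm_ind: m p => [|i m IH] p; first by rewrite mmap11 mpolyX0 mul1r.
by rewrite mmap1D // mmap1U polyendME IH mpolyXD -mulrA.
Qed.

Lemma monomial_opPE m p : mmap1 (@opP k n) m p = mderivm m p.
Proof.
elim/mnm_ind: m p => [|i m IH] p; first by rewrite mmap11 mderivm0m.
by rewrite mmap1D // mmap1U polyendME IH addmC mderivmDm mderivmU1m.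
Qed.

Definition ffactm m m' : nat := (\prod_(i < n) (m i) ^_ (m' i))%N.

Lemma ffactm_eq0 m m' : (ffactm m m' == 0%N) = ~~ lem m' m.
Proof.
apply/eqP/idP => [H|/forallPn[i]]; last first.
  rewrite -ltnNge => lt; rewrite /ffactm (bigD1 i) //=.
  by have /eqP-> : (m i) ^_ (m' i) == 0%N by rewrite -leqn0 leqNgt ffact_gt0 -ltnNge.
apply: contra_eqN H => /forallP le; rewrite -lt0n prodn_gt0 // => i.
by rewrite ffact_gt0.
Qed.

Lemma nuX_mpolyX mm m : nu (mpolyX k mm) (mpolyX k m) =
  (ffactm m (mnmr mm))%:R *: mpolyX k (mnm_add (mnml mm) (mnm_sub m (mnmr mm))).
Proof.
by rewrite /nu nordX polyendME monomial_opQE monomial_opPE mderivmX -scalerAr -mpolyXD.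
Qed.

Hypothesis char0 : [pchar k] =i pred0.

(* Evaluating at [X^b], with [b] a [p]-exponent of minimal degree in [P], singles
   out the monomials of [P] with [p]-exponent [b]. *)
Lemma nu_eq0 P : nu P = 0 -> P = 0.
Proof.
move=> nP; apply: contrapT => /eqP P0.
have [mm mmP mmin] : exists2 mm, mm \in msupp P &
    forall mm', mm' \in msupp P -> (mdeg (mnmr mm) <= mdeg (mnmr mm'))%N.
  have ex : exists d, has (fun mm => mdeg (mnmr mm) == d) (msupp P).
    by exists (mdeg (mnmr (mlead P))); apply/hasP; exists (mlead P) => //; apply: mlead_supp.
  case: (ex_minnP ex) => d /hasP[mm mmP /eqP md] dmin; exists mm => // mm' mm'P.
  by rewrite md; apply: dmin; apply/hasP; exists mm'.
have := congr1 (fun f : polyend k n => mcoeff (mnml mm) (f (mpolyX k (mnmr mm)))) nP.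
rewrite [P]mpolyE linear_sum polyend_sumE raddf_sum (big_rem mm) //= big1_seq ?addr0.
  rewrite linearZ /= nuX_mpolyX mnm_subnn addm0 !mcoeffZ mcoeffX eqxx mulr1 mcoeff0.
  apply/eqP; rewrite mulf_neq0 -?mcoeff_msupp // pchar0_natf_eq0 //.
  by rewrite ffactm_eq0 negbK lepm_refl.
move=> mm' /andP[_]; rewrite mem_rem_uniq ?msupp_uniq // inE => /andP[ne mm'P].
rewrite linearZ polyendZE nuX_mpolyX !mcoeffZ mcoeffX.
case: (boolP (lem (mnmr mm') (mnmr mm))) => [le|nle]; last first.
  by move: nle; rewrite -ffactm_eq0 => /eqP->; rewrite mul0r mulr0.
have E : mnmr mm' = mnmr mm.
  have : mdeg (mnm_sub (mnmr mm) (mnmr mm')) == 0%N.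
    have := mmin _ mm'P; rewrite -[in X in (X <= _)%N](submK le) mdegD.
    by rewrite -[X in (_ <= X)%N]add0n leq_add2r leqn0.
  by rewrite mdeg_eq0 => /eqP E; rewrite -[RHS](submK le) E add0m.
rewrite E mnm_subnn addm0; case: eqP => [El|_]; last by rewrite !mulr0.
by case/eqP: ne; rewrite -[LHS]mnmxK El E mnmxK.
Qed.

Lemma nu_inj : injective nu.
Proof.
by move=> P P' E; apply/eqP; rewrite -subr_eq0; apply/eqP/nu_eq0; rewrite linearB /= E subrr.
Qed.

End WeylOperators.

Lemma mmap1_closed (k : fieldType) n (B : algType k) (S : {pred B}) (h : 'I_n -> B) m :
  GRing.subalg_closed S -> (forall i, h i \in S) -> mmap1 h m \in S.
Proof.
move=> [S1 _ SM] hS; apply: (big_ind (fun x => x \in S)) => // i _.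
by elim: (m i) => [|j IH]; rewrite ?expr0 // exprS; apply: SM.
Qed.

Lemma nord_closed (k : fieldType) n (B : algType k) (S : {pred B}) (q p : 'I_n -> B) P :
  GRing.subalg_closed S -> (forall i, q i \in S) -> (forall i, p i \in S) ->
  nord q p P \in S.
Proof.
move=> Sc qS pS; have [S1 SL SM] := Sc.
have S0 : 0 \in S by rewrite -(addNr 1) -scaleN1r; apply: SL.
rewrite [P]mpolyE linear_sum; apply: (big_ind (fun x => x \in S)) => // [x y xS yS|m _].
  by rewrite -[x]scale1r; apply: SL.
rewrite linearZ /= nordX -[_ *: _]addr0; apply: SL => //.
by apply: SM; apply: mmap1_closed.
Qed.

Section WeylHom.
Variables (k : fieldType) (n : nat).
Hypothesis char0 : [pchar k] =i pred0.
Implicit Types (D E : weyl k n).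

Lemma nu_weyl P : nu P \in @is_weyl k n.
Proof.
by apply: nord_closed; [exact: is_weyl_closed | exact: opQ_weyl | exact: opP_weyl].
Qed.

Lemma nu_mpolyXU i : nu (mpolyX k (mnm1 (lshift n i))) = opQ k i.
Proof. by rewrite /nu nordX mnml_lshift mnmr_lshift mmap1U mmap11 mulr1. Qed.

Lemma nu_mpolyXV i : nu (mpolyX k (mnm1 (rshift n i))) = opP k i.
Proof. by rewrite /nu nordX mnml_rshift mnmr_rshift mmap1U mmap11 mul1r. Qed.

(** By [nordM], the operators that have a normally ordered form are a subalgebra, and it contains
    the generators. *)
Lemma weyl_nu (D : weyl k n) : exists P, nu P = val D.
Proof.
pose S : {pred polyend k n} := fun f => `[< exists P, nu P = f >].
suff : val D \in S by move/asboolP.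
have DP : val D \in @is_weyl k n := valP D.
move/is_weylP: DP => DP; apply: DP => [|i|i]; last 2 first.
- by apply/asboolP; exists (mpolyX k (mnm1 (lshift n i))); exact: nu_mpolyXU.
- by apply/asboolP; exists (mpolyX k (mnm1 (rshift n i))); exact: nu_mpolyXV.
split=> [|c x y /asboolP[P <-] /asboolP[P' <-]|x y /asboolP[P <-] /asboolP[P' <-]].
- by apply/asboolP; exists 1; exact: nord1.
- by apply/asboolP; exists (c *: P + P'); rewrite linearP.
- have [R _ H] := nordM (leqnSn (msize P)) (leqnSn (msize P')).
  by apply/asboolP; eexists; rewrite /nu; symmetry; apply: H; exact: canonical_pair_QP.
Qed.

Definition weyl_symbol D : mpoly (n + n) k := projT1 (cid (weyl_nu D)).

Lemma weyl_symbolK D : nu (weyl_symbol D) = val D.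
Proof. exact: projT2 (cid (weyl_nu D)). Qed.

Variables (B : algType k) (q p : 'I_n -> B).
Hypothesis qpC : canonical_pair q p.

(** The homomorphism given by the universal property of the Weyl algebra. Both hypotheses are
    arguments so that the linear and multiplicative structures, whose proofs rest on them, can be
    attached to it. *)
Definition weyl_hom (_ : [pchar k] =i pred0) (_ : canonical_pair q p) D : B :=
  nord q p (weyl_symbol D).

Local Notation Phi := (weyl_hom char0 qpC).

Lemma weyl_homE D P : nu P = val D -> Phi D = nord q p P.
Proof.
move=> E; congr (nord q p _); apply: (nu_inj char0).
by rewrite weyl_symbolK E.
Qed.

Fact weyl_hom_is_linear : linear Phi.
Proof.
move=> c D E; rewrite (@weyl_homE _ (c *: weyl_symbol D + weyl_symbol E)) ?linearP //.
by rewrite /= !weyl_symbolK.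
Qed.

(** The polynomial [R] of [nordM] is the same for the pair [opQ], [opP] as for [q], [p], so a
    product has the same normally ordered form on both sides. *)
Fact weyl_hom_monoid_morphism : monoid_morphism Phi.
Proof.
split; first by rewrite (@weyl_homE _ 1) ?nord1 // /nu nord1.
move=> D E; have [R _ H] := nordM (leqnSn (msize (weyl_symbol D))) (leqnSn (msize (weyl_symbol E))).
rewrite (weyl_homE (P := weyl_symbol D * weyl_symbol E + R)).
  by symmetry; apply: H.
rewrite /nu -H; last exact: canonical_pair_QP.
by rewrite -!/(nu _) !weyl_symbolK.
Qed.

HB.instance Definition _ := GRing.isLinear.Build k (weyl k n) B _ Phi weyl_hom_is_linear.
HB.instance Definition _ :=
  GRing.isMonoidMorphism.Build (weyl k n) B Phi weyl_hom_monoid_morphism.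

Definition weyl_lrhom : {lrmorphism weyl k n -> B} := Phi.

Lemma weyl_lrhomE D P : nu P = val D -> weyl_lrhom D = nord q p P.
Proof. exact: weyl_homE. Qed.

Lemma weyl_lrhomQ i : weyl_lrhom (weylQ k i) = q i.
Proof.
rewrite (weyl_lrhomE (P := mpolyX k (mnm1 (lshift n i)))) ?nu_mpolyXU //.
by rewrite nordX mnml_lshift mnmr_lshift mmap1U mmap11 mulr1.
Qed.

Lemma weyl_lrhomP i : weyl_lrhom (weylP k i) = p i.
Proof.
rewrite (weyl_lrhomE (P := mpolyX k (mnm1 (rshift n i)))) ?nu_mpolyXV //.
by rewrite nordX mnml_rshift mnmr_rshift mmap1U mmap11 mul1r.
Qed.

End WeylHom.

Lemma weyl_lrmorphism_eq (k : fieldType) n (B : algType k) (f g : {lrmorphism weyl k n -> B}) :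
  (forall i, f (weylQ k i) = g (weylQ k i)) ->
  (forall i, f (weylP k i) = g (weylP k i)) -> f =1 g.
Proof.
move=> fgQ fgP D.
pose S : {pred polyend k n} :=
  fun x => `[< exists E : weyl k n, val E = x /\ f E = g E >].
have Sc : GRing.subalg_closed S.
  split=> [|c x y /asboolP[D1 [<- e1]] /asboolP[D2 [<- e2]]|
           x y /asboolP[D1 [<- e1]] /asboolP[D2 [<- e2]]]; apply/asboolP.
  - by exists 1; rewrite !rmorph1.
  - by exists (c *: D1 + D2); split=> //; rewrite !linearP /= e1 e2.
  - by exists (D1 * D2); split=> //; rewrite !rmorphM /= e1 e2.
have DP : val D \in @is_weyl k n := valP D.
move/is_weylP: DP => DP; have : val D \in S.
  by apply: DP => // i; apply/asboolP; [exists (weylQ k i) | exists (weylP k i)].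
by move/asboolP => [E [/val_inj ->]].
Qed.

Lemma canonical_pair_weyl (k : fieldType) n : canonical_pair (@weylQ k n) (@weylP k n).
Proof.
have [qC pC pq] := canonical_pair_QP k n.
by split=> i j; apply: val_inj; [apply: qC | apply: pC | rewrite rmorphD rmorph_nat; apply: pq].
Qed.

(** * Partial Fourier transforms *)

Section Fourier.
Variables (k : fieldType) (n : nat) (s : 'I_n -> bool).
Hypothesis char0 : [pchar k] =i pred0.

(* [fourier] is the partial Fourier transform [Q_i |-> - P_i, P_i |-> Q_i] at the
   indices with [s i = false]. It changes the sign of the weights there. *)
Definition fourierQ (i : 'I_n) : weyl k n := if s i then weylQ k i else - weylP k i.
Definition fourierP (i : 'I_n) : weyl k n := if s i then weylP k i else weylQ k i.
Definition fourierVQ (i : 'I_n) : weyl k n := if s i then weylQ k i else weylP k i.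
Definition fourierVP (i : 'I_n) : weyl k n := if s i then weylP k i else - weylQ k i.

Let weylPQ_comm (i j : 'I_n) (ne : i != j) :
  GRing.comm (weylP k i) (weylQ k j).
Proof. by have [_ _ H] := canonical_pair_weyl k n; rewrite /GRing.comm H (negPf ne) addr0. Qed.

Lemma canonical_pair_fourier : canonical_pair fourierQ fourierP.
Proof.
have [qC pC pq] := canonical_pair_weyl k n.
split=> i j; rewrite /fourierQ /fourierP.
- have [->|ne] := eqVneq i j; first by [].
  case: ifP => si; case: ifP => sj //.
  + by apply: commrN; apply: commr_sym; apply: weylPQ_comm; rewrite eq_sym.
  + by apply: commr_sym; apply: commrN; apply: commr_sym; apply: weylPQ_comm.
  + by apply: commrN; apply: commr_sym; apply: commrN.
- have [->|ne] := eqVneq i j; first by [].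
  case: ifP => si; case: ifP => sj //; first exact: weylPQ_comm.
  by apply: commr_sym; apply: weylPQ_comm; rewrite eq_sym.
- have [->|ne] := eqVneq i j.
    by case: ifP => sj; rewrite ?(mulrN, mulNr) pq eqxx // opprD addrNK.
  rewrite addr0; case: ifP => si; case: ifP => sj.
  + exact: weylPQ_comm.
  + by apply: commrN; apply: pC.
  + exact: qC.
  + by apply: commrN; apply: commr_sym; apply: weylPQ_comm; rewrite eq_sym.
Qed.

Lemma canonical_pair_fourierV : canonical_pair fourierVQ fourierVP.
Proof.
have [qC pC pq] := canonical_pair_weyl k n.
split=> i j; rewrite /fourierVQ /fourierVP.
- have [->|ne] := eqVneq i j; first by [].
  case: ifP => si; case: ifP => sj //; last exact: weylPQ_comm.
  by apply: commr_sym; apply: weylPQ_comm; rewrite eq_sym.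
- have [->|ne] := eqVneq i j; first by [].
  case: ifP => si; case: ifP => sj //.
  + by apply: commrN; apply: weylPQ_comm.
  + by apply: commr_sym; apply: commrN; apply: weylPQ_comm; rewrite eq_sym.
  + by apply: commrN; apply: commr_sym; apply: commrN.
- have [->|ne] := eqVneq i j.
    by case: ifP => sj; rewrite ?(mulrN, mulNr) pq eqxx // opprD addrNK.
  rewrite addr0; case: ifP => si; case: ifP => sj.
  + exact: weylPQ_comm.
  + exact: pC.
  + by apply: commr_sym; apply: commrN; apply: qC.
  + by apply: commr_sym; apply: commrN; apply: weylPQ_comm; rewrite eq_sym.
Qed.

Definition fourier : {lrmorphism weyl k n -> weyl k n} :=
  weyl_lrhom char0 canonical_pair_fourier.
Definition fourierV : {lrmorphism weyl k n -> weyl k n} :=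
  weyl_lrhom char0 canonical_pair_fourierV.

Lemma fourier_weylQ i : fourier (weylQ k i) = fourierQ i. Proof. exact: weyl_lrhomQ. Qed.
Lemma fourier_weylP i : fourier (weylP k i) = fourierP i. Proof. exact: weyl_lrhomP. Qed.
Lemma fourierV_weylQ i : fourierV (weylQ k i) = fourierVQ i. Proof. exact: weyl_lrhomQ. Qed.
Lemma fourierV_weylP i : fourierV (weylP k i) = fourierVP i. Proof. exact: weyl_lrhomP. Qed.

Lemma fourierK : cancel fourier fourierV.
Proof.
move=> D; apply: (@weyl_lrmorphism_eq k n _ (fourierV \o fourier)%FUN idfun) => i /=.
  rewrite fourier_weylQ /fourierQ; case: ifP => si.
    by rewrite fourierV_weylQ /fourierVQ si.
  by rewrite rmorphN /= fourierV_weylP /fourierVP si opprK.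
rewrite fourier_weylP /fourierP; case: ifP => si.
  by rewrite fourierV_weylP /fourierVP si.
by rewrite fourierV_weylQ /fourierVQ si.
Qed.

Lemma fourierVK : cancel fourierV fourier.
Proof.
move=> D; apply: (@weyl_lrmorphism_eq k n _ (fourier \o fourierV)%FUN idfun) => i /=.
  rewrite fourierV_weylQ /fourierVQ; case: ifP => si.
    by rewrite fourier_weylQ /fourierQ si.
  by rewrite fourier_weylP /fourierP si.
rewrite fourierV_weylP /fourierVP; case: ifP => si.
  by rewrite fourier_weylP /fourierP si.
by rewrite rmorphN /= fourier_weylQ /fourierQ si opprK.
Qed.

End Fourier.

(** * Torus invariants and balanced exponents *)

Section Balanced.
Variables (k : fieldType) (n : nat) (w : 'I_n -> nat).
Hypothesis char0 : [pchar k] =i pred0.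

Definition wt (a : multinom n) : nat := (\sum_i w i * a i)%N.
Definition balanced (mm : multinom (n + n)) : bool := wt (mnml mm) == wt (mnmr mm).

Lemma wtD a b : wt (mnm_add a b) = (wt a + wt b)%N.
Proof. by rewrite /wt -big_split; apply: eq_bigr => i _; rewrite mnmDE mulnDr. Qed.

Lemma wt1 i : wt (mnm1 i) = w i.
Proof.
rewrite /wt (bigD1 i) //= mnm1E eqxx muln1 big1 ?addn0 // => j ne.
by rewrite mnm1E eq_sym (negPf ne) muln0.
Qed.

Lemma wt0 : wt (@mnm0 n) = 0%N.
Proof. by rewrite /wt big1 // => i _; rewrite mnm0E muln0. Qed.

Lemma wt_mnm1n i t : wt (mnm_muln (mnm1 i) t) = (w i * t)%N.
Proof. by elim: t => [|t IH]; rewrite ?mulm0n ?wt0 ?muln0 // mulmS wtD IH wt1 mulnS. Qed.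

Lemma natr_inj (i j : nat) : (i%:R : k) = j%:R -> i = j.
Proof.
wlog ij : i j / (i <= j)%N => [H|]; first by case/orP: (leq_total i j) => /H + /[dup] E => [/(_ E)|/(_ (esym E))].
move/eqP; rewrite eq_sym -subr_eq0 -natrB // pchar0_natf_eq0 // subn_eq0 => ji.
by apply/eqP; rewrite eqn_leq ij.
Qed.

Local Notation bz := (fun i => Posz (w i)).

Lemma conjop_monomialQ (g : torus k) a :
  conjop bz g (mmap1 (@opQ k n) a) = (val g ^+ wt a) *: mmap1 (@opQ k n) a.
Proof.
have [qC pC _] := canonical_pair_QP k n.
elim/mnm_ind: a => [|i a IH]; first by rewrite mmap11 conjop1 wt0 expr0 scale1r.
rewrite mmap1D // conjopM IH mmap1U conjopQ wtD wt1 exprD -scalerAr -scalerAl scalerA.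
by rewrite mulrC.
Qed.

Lemma conjop_monomialP (g : torus k) a :
  conjop bz g (mmap1 (@opP k n) a) = (val g ^- wt a) *: mmap1 (@opP k n) a.
Proof.
have [qC pC _] := canonical_pair_QP k n.
elim/mnm_ind: a => [|i a IH]; first by rewrite mmap11 conjop1 wt0 invr1 scale1r.
rewrite mmap1D // conjopM IH mmap1U conjopP wtD wt1 exprD -scalerAr -scalerAl scalerA.
by rewrite invfM (exprnN _ (w i)) mulrC.
Qed.

Lemma conjop_nuX (g : torus k) mm : conjop bz g (nu (mpolyX k mm)) =
  (val g ^+ wt (mnml mm) / val g ^+ wt (mnmr mm)) *: nu (mpolyX k mm).
Proof.
by rewrite /nu nordX conjopM conjop_monomialQ conjop_monomialP -scalerAr -scalerAl scalerA mulrC.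
Qed.

Lemma mcoeff_sum_mpolyX N (r : seq (multinom N)) (f : multinom N -> k) m : uniq r ->
  mcoeff m (\sum_(m' <- r) f m' *: mpolyX k m') = if m \in r then f m else 0.
Proof.
move=> ur; rewrite raddf_sum /=; case: ifP => mr.
  rewrite (bigD1_seq m) //= mcoeffZ mcoeffX eqxx mulr1 big1 ?addr0 // => m' ne.
  by rewrite mcoeffZ mcoeffX (negPf ne) mulr0.
rewrite big_seq big1 // => m' m'r; rewrite mcoeffZ mcoeffX; case: eqP => [E|]; last by rewrite mulr0.
by rewrite -E m'r in mr.
Qed.

Lemma invariant_balanced (P : mpoly (n + n) k) :
  (forall g : torus k, conjop bz g (nu P) = nu P) <->
  (forall m, m \in msupp P -> balanced m).
Proof.
have lin g : conjop bz g (nu P) = nu (\sum_(m <- msupp P)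
    (mcoeff m P * (val g ^+ wt (mnml m) / val g ^+ wt (mnmr m))) *: mpolyX k m).
  pose h : {linear polyend k n -> polyend k n} :=
    HB.pack (conjop bz g) (GRing.isLinear.Build k _ _ _ _ (conjop_linear bz g)).
  have nuE (c : multinom (n + n) -> k) (r : seq (multinom (n + n))) :
      nu (\sum_(m <- r) c m *: mpolyX k m) = \sum_(m <- r) c m *: nu (mpolyX k m).
    by rewrite linear_sum; apply: eq_bigr => m _; rewrite linearZ.
  rewrite -[LHS]/(h (nu P)) {1}[P]mpolyE !nuE linear_sum; apply: eq_bigr => m _.
  by rewrite linearZ /= /h /= conjop_nuX scalerA.
split=> [inv m mP|bal g].
  (* The single torus element 2 detects balance, since its powers are distinct in characteristic
     0. *)
  have t0 : (2%:R : k) != 0 by rewrite pchar0_natf_eq0.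
  have := inv (exist _ 2%:R t0); rewrite lin => /(nu_inj char0) /(congr1 (mcoeff m)).
  rewrite mcoeff_sum_mpolyX ?msupp_uniq // mP /= => /eqP.
  rewrite -subr_eq0 -{2}[mcoeff m P]mulr1 -mulrBr mulf_eq0 mcoeff_eq0 mP /= subr_eq0.
  move/eqP/divr1_eq; rewrite -!natrX => /natr_inj.
  by move/eqP; rewrite eqn_exp2l.
rewrite lin; congr nu; rewrite [RHS]mpolyE big_seq [RHS]big_seq; apply: eq_bigr => m mP.
by rewrite (eqP (bal m mP)) divff ?mulr1 // expf_neq0 // torus_neq0.
Qed.

End Balanced.

(** * Reduction to positive weights *)

Section InvariantSymbols.
Variables (k : fieldType) (n : nat) (b : 'I_n -> int).
Hypothesis char0 : [pchar k] =i pred0.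
Hypothesis b_neq0 : forall i, b i != 0.

Local Notation bz := (fun i => Posz `|b i|%N).
Local Notation F := (fourier (fun i => 0 < b i) char0).

(** Where [b i] is negative, [F] exchanges [Q_i] and [P_i] up to sign; their weights are opposite,
    so [b i] becomes its absolute value. It is enough to compare both sides on the generators. *)
Lemma fourier_torus_act g D :
  F (torus_act k b g D) = torus_act k bz g (F D).
Proof.
have FZ c E : F (c *: E) = c *: F E by exact: linearZ.
have TN E : torus_act k bz g (- E) = - torus_act k bz g E by exact: rmorphN.
apply: (@weyl_lrmorphism_eq k n _ (F \o torus_act k b g)%FUN
  (torus_act k bz g \o F)%FUN) => {D} i.
  rewrite -[LHS]/(F (torus_act k b g (weylQ k i))) -[RHS]/(torus_act k bz g (F (weylQ k i))).
  rewrite torus_actQ FZ fourier_weylQ /fourierQ; case: ifP => bi.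
    by rewrite torus_actQ gtz0_abs.
  rewrite TN torus_actP scalerN; congr (- (_ ^ _ *: _)).
  by rewrite ltz0_abs ?opprK // lt_neqAle b_neq0 leNgt bi.
rewrite -[LHS]/(F (torus_act k b g (weylP k i))) -[RHS]/(torus_act k bz g (F (weylP k i))).
rewrite torus_actP FZ fourier_weylP /fourierP; case: ifP => bi.
  by rewrite torus_actP gtz0_abs.
rewrite torus_actQ; congr (_ ^ _ *: _).
by rewrite ltz0_abs // lt_neqAle b_neq0 leNgt bi.
Qed.

Definition invariant_fun (_ : [pchar k] =i pred0) (a : invariants (torus_act k b)) :
  polyend k n := val (F (val a)).

Fact invariant_fun_is_linear : linear (invariant_fun char0).
Proof. by move=> c x y; rewrite /invariant_fun !linearP. Qed.

Fact invariant_fun_monoid_morphism : monoid_morphism (invariant_fun char0).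
Proof. by split=> [|x y]; rewrite /invariant_fun ?rmorph1 // !rmorphM. Qed.

HB.instance Definition _ :=
  GRing.isLinear.Build k _ _ _ (invariant_fun char0) invariant_fun_is_linear.
HB.instance Definition _ :=
  GRing.isMonoidMorphism.Build _ _ (invariant_fun char0) invariant_fun_monoid_morphism.

Definition invariant_operator : {lrmorphism invariants (torus_act k b) -> polyend k n} :=
  invariant_fun char0.

Lemma invariant_operator_inj : injective invariant_operator.
Proof.
move=> x y /= /val_inj /(can_inj (fourierK _ char0)); exact: val_inj.
Qed.

(** Injectivity and this description of the image are all that is used of the invariants below: the
    later sections treat an abstract algebra [A] with such a map [iota]. *)
Lemma invariant_operator_image f :
  (exists a, invariant_operator a = f) <->
  exists P, (forall m, m \in msupp P -> balanced (fun i => `|b i|%N) m) /\ nu P = f.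
Proof.
split=> [[a <-]|[P [balP <-]]].
  have [P PE] := weyl_nu (F (val a)); exists P; split=> //.
  apply/(invariant_balanced _ char0) => g.
  rewrite PE -[LHS]/(val (torus_act k bz g (F (val a)))) -fourier_torus_act.
  by have /is_invariantP -> := valP a.
pose D : weyl k n := exist _ (nu P) (nu_weyl P).
have Dinv : fourierV (fun i => 0 < b i) char0 D \in is_invariant (torus_act k b).
  apply/is_invariantP => g; apply: (can_inj (fourierK (fun i => 0 < b i) char0)).
  rewrite fourier_torus_act !fourierVK; apply: val_inj => /=.
  by move/(invariant_balanced _ char0): balP; apply.
pose a : invariants (torus_act k b) :=
  exist (fun x => is_invariant (torus_act k b) x) _ Dinv.
by exists a; rewrite /= /invariant_fun fourierVK.
Qed.

End InvariantSymbols.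

(** * Algebras of balanced operators *)

Section SymbolMap.
Variables (k : fieldType) (n : nat) (w : 'I_n -> nat).
Hypothesis char0 : [pchar k] =i pred0.
Variables (A : algType k) (iota : {lrmorphism A -> polyend k n}).
Hypothesis iota_inj : injective iota.
Hypothesis iota_image : forall f, (exists a, iota a = f) <->
  exists P, (forall m, m \in msupp P -> balanced w m) /\ nu P = f.

Fact symbol_exists a : exists P, (forall m, m \in msupp P -> balanced w m) /\ nu P = iota a.
Proof. by apply/iota_image; exists a. Qed.

Definition symbol a : mpoly (n + n) k := projT1 (cid (symbol_exists a)).

Lemma symbol_balanced a m : m \in msupp (symbol a) -> balanced w m.
Proof. by have [H _] := projT2 (cid (symbol_exists a)); apply: H. Qed.

Lemma nu_symbol a : nu (symbol a) = iota a.
Proof. by have [] := projT2 (cid (symbol_exists a)). Qed.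

Lemma symbolE a P : nu P = iota a -> symbol a = P.
Proof. by move=> E; apply: (nu_inj char0); rewrite nu_symbol. Qed.

Lemma symbolP c a b : symbol (c *: a + b) = c *: symbol a + symbol b.
Proof. by apply: symbolE; rewrite !linearP /= !nu_symbol. Qed.

Lemma symbol0 : symbol 0 = 0.
Proof. by apply: symbolE; rewrite !linear0. Qed.

Lemma symbol1 : symbol 1 = 1.
Proof. by apply: symbolE; rewrite rmorph1 /nu nord1. Qed.

Lemma symbolB a b : symbol (a - b) = symbol a - symbol b.
Proof. by apply: symbolE; rewrite !linearB /= !nu_symbol. Qed.

Lemma symbol_inj : injective symbol.
Proof. by move=> a b E; apply: iota_inj; rewrite -!nu_symbol E. Qed.

Lemma symbol_eq0 a : (symbol a == 0) = (a == 0).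
Proof. by rewrite -symbol0 (inj_eq symbol_inj). Qed.

Lemma symbol_surj P : (forall m, m \in msupp P -> balanced w m) -> exists a, symbol a = P.
Proof.
move=> bal; have /iota_image[a aP] : exists P', (forall m, m \in msupp P' -> balanced w m) /\ nu P' = nu P.
  by exists P.
by exists a; apply: symbolE.
Qed.

Lemma symbolM a b d e : (msize (symbol a) <= d.+1)%N -> (msize (symbol b) <= e.+1)%N ->
  exists2 R, (msize R <= d + e)%N & symbol (a * b) = symbol a * symbol b + R.
Proof.
move=> ad be; have [R Rs H] := nordM ad be; exists R => //.
by apply: symbolE; rewrite rmorphM /= -!nu_symbol /nu H //; exact: canonical_pair_QP.
Qed.

Lemma balancedB m m' : lem m' m -> balanced w m -> balanced w m' -> balanced w (mnm_sub m m').
Proof.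
rewrite /balanced => le /eqP bm /eqP bm'.
by rewrite -(eqn_add2r (wt w (mnml m'))) {2}bm' -!wtD -mnmlD -mnmrD submK ?bm.
Qed.

Lemma msize_symbol a : a != 0 -> msize (symbol a) = (mdeg (mlead (symbol a))).+1.
Proof. by move=> a0; rewrite -mlead_deg // symbol_eq0. Qed.

(** A difference of balanced exponents is balanced, so the quotient of the two leading terms is the
    symbol of some [s] in [A]. Both [s * x] and [x * s] have the leading term of [y], which handles
    left and right ideals at once. *)
Lemma symbol_reduce x y : x != 0 -> y != 0 ->
  lem (mlead (symbol x)) (mlead (symbol y)) ->
  exists s, forall t, t = s * x \/ t = x * s ->
    y - t = 0 \/ (mlead (symbol (y - t)) < mlead (symbol y))%O.
Proof.
move=> x0 y0 le; set p := symbol x; set q := symbol y; pose d := mnm_sub (mlead q) (mlead p).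
have p0 : p != 0 by rewrite symbol_eq0.
have q0 : q != 0 by rewrite symbol_eq0.
have dE : mnm_add d (mlead p) = mlead q by rewrite submK.
pose c := mcoeff (mlead q) q / mcoeff (mlead p) p.
have c0 : c != 0 by rewrite mulf_neq0 // ?invr_eq0 mleadc_eq0.
have [|s sE] := @symbol_surj (c *: mpolyX k d).
  move=> m; rewrite msuppMCX // inE => /eqP->.
  by apply: balancedB => //; apply: symbol_balanced; apply: mlead_supp.
have ss : (msize (symbol s) <= (mdeg d).+1)%N by rewrite sE msizeZ // msizeX.
have xs : (msize p <= (mdeg (mlead p)).+1)%N by rewrite msize_symbol.
exists s => t tE.
have [R Rs tR] : exists2 R, (msize R <= mdeg (mlead q))%N &
    symbol t = c *: (mpolyX k d * p) + R.
  rewrite -dE mdegD; case: tE => ->.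
    by have [R Rs ->] := symbolM ss xs; exists R; rewrite // sE -scalerAl.
  have [R Rs ->] := symbolM xs ss; exists R; first by rewrite addnC.
  by rewrite sE -scalerAr [symbol x * _]mulrC.
have [->|yt] := eqVneq (y - t) 0; [by left | right].
have D0 : symbol (y - t) != 0 by rewrite symbol_eq0.
(* [R] has smaller degree than [mlead q], and the monomial order compares degrees first. *)
have supp m : m \in msupp (symbol (y - t)) -> (m <= mlead q)%O.
  rewrite leNgt mcoeff_msupp symbolB tR mcoeffB mcoeffD mcoeffZ => H.
  apply: contraNN H => lt; rewrite mcoeff_gt_mlead // mcoeff_gt_mlead.
    rewrite mulr0 !sub0r add0r oppr_eq0; apply: contraTT lt => Rm.
    by rewrite -leNgt ltW // lt_mdeg_ltmc //; apply: leq_trans Rs; apply: msize_mdeg_lt; rewrite mcoeff_msupp.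
  by rewrite mleadM // ?mleadXm ?dE // -msize_poly_eq0 msizeX.
(* The inequality is strict because [c] was chosen to cancel the coefficient at [mlead q]. *)
rewrite lt_neqAle supp ?mlead_supp // andbT; apply: contraNneq (D0) => E.
rewrite -mleadc_eq0 E symbolB tR mcoeffB mcoeffD mcoeffZ -[in X in _ * X]dE.
rewrite [mpolyX _ _ * _]mulrC mcoeffMX divfK ?mleadc_eq0 //.
rewrite opprD addrA subrr sub0r oppr_eq0 mcoeff_eq0; apply/negP => /msize_mdeg_lt.
by rewrite ltnNge Rs.
Qed.

Lemma balanced_noetherian : noetherian A.
Proof.
split.
  apply: (@noetherian_module_lead A A^o (n + n) (fun a => mlead (symbol a))) => x y x0 y0 le.
  have [s H] := symbol_reduce x0 y0 le; exists s; apply: H; by left.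
apply: (@noetherian_module_lead A^c (A^c)^o (n + n) (fun a => mlead (symbol a))) => x y x0 y0 le.
have [s H] := symbol_reduce x0 y0 le; exists s; apply: H; by right.
Qed.

End SymbolMap.

(** * Weight spaces of the polynomial ring *)

Section WeightSpaces.
Variables (k : fieldType) (n : nat) (w : 'I_n -> nat).

Definition of_weight e : {pred mpoly n k} := fun p => all (fun m => wt w m == e) (msupp p).

Lemma of_weightP e p :
  reflect (forall m, mcoeff m p != 0 -> wt w m = e) (p \in of_weight e).
Proof.
apply: (iffP allP) => H m; first by rewrite -mcoeff_msupp => /H /eqP.
by rewrite mcoeff_msupp => /H /eqP.
Qed.

Fact of_weight_submod_closed e : GRing.submod_closed (of_weight e).
Proof.
split; first by apply/of_weightP => m; rewrite mcoeff0 eqxx.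
move=> c x y /of_weightP xe /of_weightP ye; apply/of_weightP => m.
rewrite mcoeffD mcoeffZ; have [y0|/ye//] := eqVneq (mcoeff m y) 0.
by rewrite y0 addr0 mulf_eq0 negb_or => /andP[_ /xe].
Qed.

Lemma of_weight_mpolyX m : mpolyX k m \in of_weight (wt w m).
Proof. by apply/of_weightP => m'; rewrite mcoeffX; have [->|_] := eqVneq m m'; rewrite ?eqxx. Qed.

Lemma nu_of_weight P e p : (forall m, m \in msupp P -> balanced w m) ->
  p \in of_weight e -> nu P p \in of_weight e.
Proof.
move=> bal pe; have [W0 WL] := of_weight_submod_closed e.
have WD x y : x \in of_weight e -> y \in of_weight e -> x + y \in of_weight e.
  by move=> xe ye; rewrite -[x]scale1r; apply: WL.
have WZ c x : x \in of_weight e -> c *: x \in of_weight e.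
  by move=> xe; rewrite -[_ *: _]addr0; apply: WL.
rewrite [P]mpolyE linear_sum polyend_sumE big_seq.
apply: (big_ind (fun x => x \in of_weight e)) => // mm mmP.
rewrite linearZ polyendZE; apply: (WZ); rewrite [p]mpolyE linear_sum big_seq.
apply: (big_ind (fun x => x \in of_weight e)) => // m; rewrite mcoeff_msupp => mp.
rewrite linearZ; apply: (WZ); rewrite nuX_mpolyX.
have [le|] := boolP (lem (mnmr mm) m); last first.
  by rewrite -ffactm_eq0 => /eqP->; rewrite scale0r.
apply: (WZ); move/of_weightP: pe => /(_ _ mp) <-.
have <- : wt w (mnm_add (mnml mm) (mnm_sub m (mnmr mm))) = wt w m.
  by rewrite wtD (eqP (bal _ mmP)) -wtD addmC submK.
exact: of_weight_mpolyX.
Qed.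

Variables (A : algType k) (iota : {lrmorphism A -> polyend k n}).

Definition preserves_weights := forall a e p, p \in of_weight e -> iota a p \in of_weight e.

(* The first argument is only there to carry the [A]-module structure. *)
Definition weight_space (_ : preserves_weights) (e : nat) : Type :=
  {p : mpoly n k | of_weight e p}.

Hypothesis iota_weight : preserves_weights.
Variable e : nat.
Local Notation V := (weight_space iota_weight e).

HB.instance Definition _ := SubChoice.on V.
HB.instance Definition _ := GRing.SubChoice_isSubZmodule.Build (mpoly n k) (of_weight e) V
  (GRing.submod_closedB (of_weight_submod_closed e)).

Definition weight_scale (a : A) (v : V) : V :=
  exist (fun p => of_weight e p) (iota a (val v)) (iota_weight a (valP v)).

Fact weight_scaleA a a' v : weight_scale a (weight_scale a' v) = weight_scale (a * a') v.
Proof. by apply: val_inj; rewrite /= rmorphM. Qed.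
Fact weight_scale1 : left_id 1 weight_scale.
Proof. by move=> v; apply: val_inj; rewrite /= rmorph1. Qed.
Fact weight_scaleDr : right_distributive weight_scale +%R.
Proof. by move=> a u v; apply: val_inj; rewrite /= linearD. Qed.
Fact weight_scaleDl v : {morph weight_scale^~ v : a b / a + b}.
Proof. by move=> a b; apply: val_inj; rewrite /= linearD. Qed.

HB.instance Definition _ := GRing.Zmodule_isLmodule.Build A V
  weight_scaleA weight_scale1 weight_scaleDr weight_scaleDl.

Hypothesis w_gt0 : forall i, (0 < w i)%N.

Lemma mdeg_le_wt m : (mdeg m <= wt w m)%N.
Proof. by rewrite mdegE; apply: leq_sum => i _; rewrite leq_pmull. Qed.

Lemma weight_space_finite_dimensional : @finite_dimensional k A V.
Proof.
pose T := bmultinom n e.+1.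
(* The degree is at most the weight, so the monomials of degree at most [e] span. [insubd] sends
   those of another weight to 0; their coefficients in [x] vanish as well. *)
exists #|{: T}|, (fun i => insubd (0 : V) (mpolyX k (bmnm (enum_val i)))) => x.
have xe : val x \in of_weight e := valP x.
exists (fun i => mcoeff (bmnm (enum_val i)) (val x)); apply: val_inj.
have sx : (msize (val x) <= e.+1)%N.
  apply/msize_leP => m mx; rewrite ltnS; apply: leq_trans (mdeg_le_wt m) _.
  by move/of_weightP: xe => ->.
rewrite {1}(mpolywE sx) raddf_sum (reindex (@enum_val _ (mem {: T}))) /=; last first.
  by apply: onW_bij; exact: enum_val_bij.
apply: eq_bigr => i _; rewrite linearZ rmorph1 polyendZE /=.
have [->|mx] := eqVneq (mcoeff (bmnm (enum_val i)) (val x)) 0; first by rewrite !scale0r.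
congr (_ *: _); rewrite -[RHS]/(val (insubd (0 : V) (mpolyX k (bmnm (enum_val i))))) insubdK //.
move/of_weightP: xe => /(_ _ mx); move: (bmnm _) => m <-; exact: of_weight_mpolyX.
Qed.

End WeightSpaces.

Section EnoughFiniteDimensional.
Variables (k : fieldType) (n : nat) (w : 'I_n -> nat).
Hypothesis w_gt0 : forall i, (0 < w i)%N.
Variables (A : algType k) (iota : {lrmorphism A -> polyend k n}).
Hypothesis iota_inj : injective iota.
Hypothesis iota_image : forall f, (exists a, iota a = f) <->
  exists P, (forall m, m \in msupp P -> balanced w m) /\ nu P = f.

Lemma balanced_enough_finite_dimensional : enough_finite_dimensional A.
Proof.
move=> a aP; apply: iota_inj; rewrite linear0; apply: polyend_ext => m.
have pres : preserves_weights w iota.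
  move=> c e p pe; have /iota_image[P [balP <-]] : exists c', iota c' = iota c by exists c.
  exact: nu_of_weight.
have := aP _ (weight_space_finite_dimensional pres (wt w m) w_gt0).
move=> /(_ (exist (fun p => of_weight w (wt w m) p) _ (of_weight_mpolyX k w m))).
by move/(congr1 val).
Qed.

End EnoughFiniteDimensional.

(** * Complete reducibility *)

(** Each [v] in [s] generates a simple or zero module. A complement [C] of [N] is built along [s]: a
    generator [x] that already lies in [N + C] changes nothing, and otherwise [A x] meets [N + C]
    trivially and is added to [C]. *)
Lemma completely_reducible_simple_generators (k : fieldType) (A : algType k) (M : lmodType A) (s : seq M) :
  (forall v, v \in s -> forall a : A, a *: v != 0 -> exists b : A, b *: (a *: v) = v) ->
  (forall N : {pred M}, GRing.submod_closed N -> (forall v, v \in s -> v \in N) ->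
     forall x, x \in N) ->
  completely_reducible M.
Proof.
move=> simple gen N Ncl; have [N0 NL] := Ncl.
have closedN (K : {pred M}) x : GRing.submod_closed K -> x \in K -> - x \in K.
  by move=> [K0 KL] xK; rewrite -scaleN1r -[_ *: _]addr0; apply: KL.
suff [C [Ccl NC Cs]] : exists C : {pred M}, [/\ GRing.submod_closed C,
    forall x, x \in N -> x \in C -> x = 0
  & forall v, v \in s -> exists y z, [/\ y \in N, z \in C & v = y + z]].
  have [C0 CL] := Ccl; exists C; split=> // x.
  pose K : {pred M} := fun x => `[< exists y z, [/\ y \in N, z \in C & x = y + z] >].
  suff : x \in K by move/asboolP.
  apply: gen => [|v vs]; last by apply/asboolP; apply: Cs.
  split=> [|a u v /asboolP[y [z [yN zC ->]]] /asboolP[y' [z' [yN' zC' ->]]]]; apply/asboolP.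
    by exists 0, 0; rewrite addr0.
  exists (a *: y + y'), (a *: z + z'); split; [exact: NL | exact: CL |].
  by rewrite scalerDr addrACA.
elim: s {gen} simple => [_|x s IH simple].
  exists (fun x => x == 0); split => //; last by move=> x _ /eqP.
  split=> [|a u v /eqP-> /eqP->]; first exact: eqxx.
  by rewrite scaler0 addr0; apply: eqxx.
have {IH} [C [Ccl NC Cs]] := IH (fun v vs => simple v (@mem_behead _ (x :: s) _ vs)).
have [C0 CL] := Ccl.
have [xNC|xNC] := pselect (exists y z, [/\ y \in N, z \in C & x = y + z]).
  by exists C; split=> // v; rewrite inE => /predU1P[->|/Cs].
pose C' : {pred M} := fun v => `[< exists z a, z \in C /\ v = z + a *: x >].
exists C'; split.
- split=> [|c u v /asboolP[z [a [zC ->]]] /asboolP[z' [a' [zC' ->]]]]; apply/asboolP.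
    by exists 0, 0; rewrite scale0r addr0.
  exists (c *: z + z'), (c * a + a'); split; first exact: CL.
  by rewrite scalerDr scalerDl addrACA scalerA.
- move=> v vN /asboolP[z [a [zC E]]].
  have [ax0|ax0] := eqVneq (a *: x) 0.
    by apply: NC => //; rewrite E ax0 addr0.
  (* If [a *: x] were nonzero in [N + C], simplicity would bring [x] itself into [N + C]. *)
  have [b bE] := simple x (mem_head _ _) a ax0; case: xNC.
  exists (b *: v), (b *: (- z)); split.
  + by rewrite -[_ *: _]addr0; apply: NL.
  + by rewrite -[_ *: _]addr0; apply: CL => //; apply: closedN.
  + by rewrite -scalerDr E addrAC subrr add0r bE.
- move=> v; rewrite inE => /predU1P[->|/Cs[y [z [yN zC ->]]]].
    exists 0, x; split=> //; last by rewrite add0r.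
    by apply/asboolP; exists 0, 1; rewrite scale1r add0r.
  exists y, z; split=> //; apply/asboolP; exists z, 0.
  by rewrite scale0r addr0.
Qed.

(** * Polynomials in an operator on a module *)

Section Modules.
Variables (k : fieldType) (A : algType k).
Implicit Types (M : lmodType A) (p q : {poly k}).

Lemma alg_mulC (a : A) (c : k) : a * c%:A = c%:A * a.
Proof. by rewrite mulr_algl mulr_algr. Qed.

Lemma algM (c d : k) : c%:A * d%:A = (c * d)%:A :> A.
Proof. by rewrite mulr_algl scalerA. Qed.

Lemma horner_alg_eigenvector M (a : A) (v : M) (c : k) p :
  a *: v = c%:A *: v -> horner_alg a p *: v = (p.[c])%:A *: v.
Proof.
move=> av; elim/poly_ind: p => [|p d IH]; first by rewrite linear0 horner0 !scale0r.
rewrite rmorphD rmorphM /= horner_algX horner_algC scalerDl -scalerA av hornerMXaddC.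
rewrite scalerDl scalerDl; congr (_ + _).
by rewrite [LHS]scalerA alg_mulC -[LHS]scalerA IH [LHS]scalerA algM mulrC.
Qed.

Lemma horner_alg_intertwine (a b x : A) p :
  a * x = x * b -> horner_alg a p * x = x * horner_alg b p.
Proof.
move=> abx; elim/poly_ind: p => [|p d IH]; first by rewrite !linear0 mul0r mulr0.
rewrite !rmorphD !rmorphM /= !horner_algX !horner_algC mulrDl mulrDr -mulrA abx.
by rewrite mulrA IH -mulrA mulr_algl mulr_algr.
Qed.

Lemma horner_alg_translate (a : A) (c : k) p :
  horner_alg (a + c%:A) p = horner_alg a (p \Po ('X + c%:P)).
Proof.
elim/poly_ind: p => [|p d IH]; first by rewrite comp_poly0 !linear0.
rewrite comp_polyD comp_polyM comp_polyX comp_polyC !rmorphD !rmorphM /= IH.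
by rewrite !horner_algX !horner_algC rmorphD /= horner_algX horner_algC.
Qed.

(** Cayley-Hamilton. The [e i] only span [M], so [T] is one choice of matrix for [a], but [p(a)] is
    still expressed by [p(T)]. An empty spanning family is treated apart, square matrices forming a
    nonzero ring only in positive size. *)
Lemma annihilating_polynomial M (a : A) : @finite_dimensional k A M ->
  exists2 p, p != 0 & annihilates (horner_alg a p) M.
Proof.
move=> [[|d] [e eP]].
  exists 1; first exact: oner_neq0.
  by move=> x; have [c ->] := eP x; rewrite big_ord0 scaler0.
have /choice[t tP] := fun i => eP (a *: e i).
pose T : 'M[k]_d.+1 := \matrix_(i, j) t i j.
have key p i : horner_alg a p *: e i = \sum_j (horner_mx T p i j)%:A *: e j.
  elim/poly_ind: p i => [|p c IH] i.
    rewrite !linear0 scale0r big1 // => j _; first by rewrite mxE scale0r scale0r.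
  rewrite !rmorphD mulrC !rmorphM /= horner_algX horner_algC horner_mx_X horner_mx_C.
  rewrite scalerDl -scalerA IH scaler_sumr.
  have -> : \sum_j a *: ((horner_mx T p i j)%:A *: e j) =
      \sum_j (\sum_l (horner_mx T p i l * T l j))%:A *: e j.
    under eq_bigr => j _ do rewrite scalerA alg_mulC -scalerA tP scaler_sumr.
    rewrite exchange_big /=; apply: eq_bigr => j _.
    rewrite scaler_suml scaler_suml; apply: eq_bigr => l _.
    by rewrite scalerA algM mxE.
  have -> : T * horner_mx T p = horner_mx T p *m T.
    have : horner_mx T ('X * p) = horner_mx T (p * 'X) by rewrite mulrC.
    by rewrite !rmorphM /= horner_mx_X.
  under [RHS]eq_bigr => j _ do rewrite !mxE scalerDl scalerDl.
  rewrite big_split /=; congr (_ + _).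
  rewrite (bigD1 i) //= eqxx mulr1n big1 ?addr0 // => j ji.
  by rewrite eq_sym (negPf ji) mulr0n scale0r scale0r.
exists (char_poly T); first exact/monic_neq0/char_poly_monic.
move=> x; have [c ->] := eP x; rewrite scaler_sumr big1 // => i _.
rewrite scalerA alg_mulC -scalerA key Cayley_Hamilton.
by rewrite big1 ?scaler0 // => j _; rewrite mxE scale0r scale0r.
Qed.

Lemma annihilatesM_l M (a b : A) : annihilates b M -> annihilates (a * b) M.
Proof. by move=> H x; rewrite -scalerA H scaler0. Qed.
Lemma annihilatesM_r M (a b : A) : annihilates a M -> annihilates (a * b) M.
Proof. by move=> H x; rewrite -scalerA H. Qed.
Lemma annihilatesD M (a b : A) : annihilates a M -> annihilates b M -> annihilates (a + b) M.
Proof. by move=> Ha Hb x; rewrite scalerDl Ha Hb addr0. Qed.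

End Modules.

(** A common root of [p] and its translate by [c *+ m] makes [c *+ m] a difference of two roots of
    [p]. There are finitely many such differences, and infinitely many multiples of [c] in
    characteristic 0. *)
Lemma coprimep_translate (k : closedFieldType) (c : k) (p : {poly k}) :
  [pchar k] =i pred0 -> c != 0 -> p != 0 ->
  exists2 m : nat, (0 < m)%N & coprimep p (p \Po ('X + (c *+ m)%:P)).
Proof.
move=> char0 c0 p0; have [rs pE] := closed_field_poly_normal p.
have rootE x : root p x -> x \in rs.
  rewrite pE rootZ ?lead_coef_eq0 // root_prod_XsubC; exact.
pose L := [seq r' - r | r <- rs, r' <- rs].
have cinj : injective (fun m : nat => c *+ m).
  by move=> i j; rewrite -[c *+ i]mulr_natr -[c *+ j]mulr_natr => /(mulfI c0) /(natr_inj char0).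
have [m mL] : exists m, c *+ m.+1 \notin L.
  apply: contrapT => nex.
  have : {subset [seq c *+ m | m <- iota 1 (size L).+1] <= L}.
    move=> x /mapP[[|m]]; rewrite mem_iota // => _ ->.
    by apply: contrapT => /negP nL; apply: nex; exists m.
  have U : uniq [seq c *+ m | m <- iota 1 (size L).+1] by rewrite (map_inj_uniq cinj) iota_uniq.
  by move/(uniq_leq_size U); rewrite size_map size_iota ltnn.
exists m.+1 => //; apply: Pdiv.ClosedField.root_coprimep => x xp.
rewrite horner_comp hornerD hornerX hornerC; apply: contra mL => /rootE xm.
by apply/allpairsP; exists (x, x + c *+ m.+1); split; [exact: rootE | | rewrite /= addrC addKr].
Qed.

(* If [p(h)] is zero on [M], then so are [x ^+ m * p(h)] and
   [x ^+ m * p(h + m c) = p(h) * x ^+ m], and the two polynomials in [h] are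
   coprime for some [m]. *)
Lemma ladder_operator_nilpotent (k : closedFieldType) (A : algType k) (M : lmodType A)
    (h x : A) (c : k) :
  [pchar k] =i pred0 -> c != 0 -> @finite_dimensional k A M ->
  h * x = x * (h + c%:A) -> exists2 m : nat, (0 < m)%N & annihilates (x ^+ m) M.
Proof.
move=> char0 c0 fdM hx.
have hxm m : h * x ^+ m = x ^+ m * (h + (c *+ m)%:A).
  elim: m => [|m IH]; first by rewrite expr0 mulr1 mul1r mulr0n scale0r addr0.
  rewrite exprS mulrA hx -mulrA mulrDl IH -alg_mulC -mulrDr -mulrA.
  by rewrite -addrA -scalerDl -mulrSr.
have [p p0 pM] := annihilating_polynomial h fdM.
have [m m0 cop] := coprimep_translate char0 c0 p0.
exists m => //; have [[u v] /= uv] := Bezout_eq1_coprimepP _ _ cop.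
rewrite -[x ^+ m]mulr1 -(rmorph1 (horner_alg h)) -uv rmorphD !rmorphM /= mulrDr.
apply: annihilatesD; first by rewrite mulrA; apply: annihilatesM_l.
rewrite -horner_alg_translate [horner_alg h v * _](_ : _ = horner_alg (h + (c *+ m)%:A) p * horner_alg h v).
  by rewrite mulrA -(horner_alg_intertwine p (hxm m)) -mulrA; apply: annihilatesM_r.
by rewrite horner_alg_translate -!rmorphM mulrC.
Qed.

(** The shifted falling factorial (X + s)(X + s - 1)...(X + s - a + 1), with roots -s, 1 - s, ..., a
    - 1 - s. For [s = 0] the roots are nonnegative; for [s = a] they are negative. *)
Definition falling_poly (k : fieldType) (a : nat) (s : int) : {poly k} :=
  \prod_(j < a) ('X - (j%:Z - s)%:~R%:P).

Lemma horner_falling_poly (k : fieldType) a s (x : k) :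
  (falling_poly k a s).[x] = \prod_(j < a) (x + s%:~R - j%:R).
Proof.
rewrite /falling_poly horner_prod; apply: eq_bigr => j _.
by rewrite !hornerE intrB opprB addrA.
Qed.

Lemma falling_poly_nat (k : fieldType) a s (x : k) N : x + s%:~R = N%:R ->
  (falling_poly k a s).[x] = (N ^_ a)%:R.
Proof.
move=> E; rewrite horner_falling_poly {}E; elim: a => [|a IH]; first by rewrite big_ord0 ffactn0.
rewrite big_ord_recr /= IH ffactnSr natrM; have [le|lt] := leqP a N; first by rewrite natrB.
by rewrite ffact_small ?mul0r.
Qed.

Lemma falling_poly_root_exists (k : fieldType) a s (x : k) : (falling_poly k a s).[x] = 0 ->
  exists2 j : nat, (j < a)%N & x = (j%:Z - s)%:~R.
Proof.
rewrite horner_falling_poly => /eqP /prodf_eq0 [j _]; rewrite subr_eq0 => /eqP E.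
by exists j => //; rewrite intrB -pmulrn -E addrK.
Qed.

Section IntegerRoots.
Variable k : fieldType.
Hypothesis char0 : [pchar k] =i pred0.

Lemma intr_inj0 : injective (fun z : int => z%:~R : k).
Proof.
move=> x y /eqP; rewrite -subr_eq0 -intrB => /eqP.
case: (intP (x - y)) (subr_eq0 x y) => [|d|d].
- by rewrite eqxx => /esym/eqP->.
- by move=> _ /eqP; rewrite -pmulrn pchar0_natf_eq0.
- by move=> _ /eqP; rewrite mulrNz oppr_eq0 -pmulrn pchar0_natf_eq0.
Qed.

Lemma falling_poly_root a s (z : int) : (falling_poly k a s).[z%:~R] = 0 ->
  exists2 j : nat, (j < a)%N & z = j%:Z - s.
Proof. by move=> /falling_poly_root_exists[j ja /intr_inj0 E]; exists j. Qed.

End IntegerRoots.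

(** * Balanced monomials as elements of the algebra *)

Section BalancedOperators.
Variables (k : fieldType) (n : nat) (w : 'I_n -> nat).
Hypothesis char0 : [pchar k] =i pred0.
Variables (A : algType k) (iota : {lrmorphism A -> polyend k n}).
Hypothesis iota_inj : injective iota.
Hypothesis iota_image : forall f, (exists a, iota a = f) <->
  exists P, (forall m, m \in msupp P -> balanced w m) /\ nu P = f.
Implicit Types (mm : multinom (n + n)) (m l r d : multinom n) (i j : 'I_n).

Fact monomial_op_exists : exists T : multinom (n + n) -> A,
  forall mm, balanced w mm -> iota (T mm) = nu (mpolyX k mm).
Proof.
have H mm : exists a, balanced w mm -> iota a = nu (mpolyX k mm).
  have [bal|nbal] := boolP (balanced w mm); last by exists 0.
  have /iota_image[a aE] : exists P, (forall mm', mm' \in msupp P -> balanced w mm') /\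
      nu P = nu (mpolyX k mm).
    by exists (mpolyX k mm); split=> // mm'; rewrite msuppX inE => /eqP->.
  by exists a.
by have [T TP] := choice H; exists T.
Qed.

(* Unspecified at the exponents which are not balanced. *)
Definition monomial_op : multinom (n + n) -> A := projT1 (cid monomial_op_exists).
Local Notation T l r := (monomial_op (mnmx l r)).

Lemma monomial_opE mm : balanced w mm -> iota (monomial_op mm) = nu (mpolyX k mm).
Proof. exact: (projT2 (cid monomial_op_exists)). Qed.

Lemma balancedE l r : balanced w (mnmx l r) = (wt w l == wt w r).
Proof. by rewrite /balanced mnmxl mnmxr. Qed.

Lemma iota_monomialX l r m : wt w l = wt w r ->
  iota (T l r) (mpolyX k m) = (ffactm m r)%:R *: mpolyX k (mnm_add l (mnm_sub m r)).
Proof.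
by move=> bal; rewrite monomial_opE ?balancedE ?bal // nuX_mpolyX mnmxl mnmxr.
Qed.

Lemma iota_ext a b : (forall m, iota a (mpolyX k m) = iota b (mpolyX k m)) -> a = b.
Proof. by move=> H; apply/iota_inj/polyend_ext. Qed.

Definition theta i : A := T (mnm1 i) (mnm1 i).

Lemma ffactm_mnm1 m i a : ffactm m (mnm_muln (mnm1 i) a) = ((m i) ^_ a)%N.
Proof.
rewrite /ffactm (bigD1 i) //= mulmnE mnm1E eqxx mul1n big1 ?muln1 // => j ji.
by rewrite mulmnE mnm1E eq_sym (negPf ji) ffactn0.
Qed.

Lemma iota_thetaX i m : iota (theta i) (mpolyX k m) = (m i)%:R *: mpolyX k m.
Proof.
have E : ffactm m (mnm1 i) = m i by rewrite -[mnm1 i]mulm1n ffactm_mnm1 ffactn1.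
rewrite iota_monomialX // E.
have [->|mi] := eqVneq (m i) 0%N; first by rewrite !scale0r.
by rewrite addmC submK ?lep1mP.
Qed.

Lemma iota_horner_eigen a p (c : k) f :
  iota a p = c *: p -> iota (horner_alg a f) p = f.[c] *: p.
Proof.
move=> ap; elim/poly_ind: f => [|f d IH]; first by rewrite !linear0 horner0 scale0r.
rewrite rmorphD rmorphM /= horner_algX horner_algC rmorphD rmorphM /= hornerMXaddC scalerDl.
by rewrite linearZ rmorph1 -[LHS]/(iota (horner_alg a f) (iota a p) + d *: p) ap linearZ /= IH scalerA mulrC.
Qed.

Lemma iota_horner_thetaX i f m :
  iota (horner_alg (theta i) f) (mpolyX k m) = f.[(m i)%:R] *: mpolyX k m.
Proof. by apply: iota_horner_eigen; exact: iota_thetaX. Qed.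

Lemma iotaME a b p : iota (a * b) p = iota a (iota b p).
Proof. by rewrite rmorphM. Qed.

Lemma iotaZE a c p : iota a (c *: p) = c *: iota a p.
Proof. exact: linearZ. Qed.

Lemma theta_comm i j : theta i * theta j = theta j * theta i.
Proof.
by apply: iota_ext => m; rewrite !(iotaME, iotaZE, iota_thetaX) !scalerA mulrC.
Qed.

(** Thus [T l r] shifts the eigenvalues of [theta i] by [l i - r i]. The identity is checked on
    monomials, both sides vanishing on those not divisible by [r]. *)
Lemma theta_monomial i l r : wt w l = wt w r ->
  theta i * T l r = T l r * (theta i + ((l i)%:Z - (r i)%:Z)%:~R%:A).
Proof.
move=> bal; apply: iota_ext => m; rewrite mulrDr alg_mulC mulr_algl rmorphD polyendDE.
have -> c a p : iota (c *: a) p = c *: iota a p by rewrite linearZ.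
rewrite !(iotaME, iotaZE, iota_thetaX, iota_monomialX _ bal) !scalerA -scalerDl; congr (_ *: _).
have [le|] := boolP (lem r m); last by rewrite -ffactm_eq0 => /eqP->; rewrite !(mul0r, mulr0) addr0.
rewrite -mulrDl [LHS]mulrC; congr (_ * _).
rewrite mnmDE mnmBE natrD natrB ?(forallP le) // intrB -!pmulrn.
by rewrite addrCA addrC -!addrA.
Qed.

End BalancedOperators.

Lemma ffactnD a b c : (a ^_ (b + c) = a ^_ b * (a - b) ^_ c)%N.
Proof.
elim: c => [|c IH]; first by rewrite addn0 ffactn0 muln1.
by rewrite addnS !ffactnSr IH subnDA mulnA.
Qed.

Lemma mmap1_muln (k : fieldType) (B : algType k) n (h : 'I_n -> B) m a :
  (forall i j, GRing.comm (h i) (h j)) -> mmap1 h (mnm_muln m a) = mmap1 h m ^+ a.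
Proof.
move=> hC; elim: a => [|a IH]; first by rewrite mulm0n mmap11 expr0.
by rewrite mulmS mmap1D // IH exprS.
Qed.

Section BalancedRelations.
Variables (k : fieldType) (n : nat) (w : 'I_n -> nat).
Hypothesis char0 : [pchar k] =i pred0.
Variables (A : algType k) (iota : {lrmorphism A -> polyend k n}).
Hypothesis iota_inj : injective iota.
Hypothesis iota_image : forall f, (exists a, iota a = f) <->
  exists P, (forall m, m \in msupp P -> balanced w m) /\ nu P = f.
Implicit Types (mm : multinom (n + n)) (m l r d : multinom n) (i j : 'I_n).

Local Notation T l r := (monomial_op iota_image (mnmx l r)).
Local Notation theta := (theta iota_image).

Definition theta_prod (f : 'I_n -> {poly k}) : A :=
  \prod_i horner_alg (theta i) (f i).

Lemma iota_theta_prodX f m :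
  iota (theta_prod f) (mpolyX k m) = (\prod_i (f i).[(m i)%:R]) *: mpolyX k m.
Proof.
rewrite /theta_prod; elim: index_enum => [|i s IH].
  by rewrite !big_nil rmorph1 scale1r.
by rewrite !big_cons iotaME IH iotaZE iota_horner_thetaX scalerA mulrC.
Qed.

(** On X^m, [T l r] multiplies by the falling factorials of m of length [r] and moves to exponent m
    - r + l; [T r l] moves back, with falling factorials of m - r + l of length [l]. *)
Lemma lowering_raising l r : wt w l = wt w r ->
  T r l * T l r = theta_prod (fun i =>
    falling_poly k (r i) 0 * falling_poly k (l i) ((l i)%:Z - (r i)%:Z)).
Proof.
move=> bal; apply: (iota_ext iota_inj) => m.
rewrite iota_theta_prodX iotaME (iota_monomialX _ _ bal) iotaZE.
rewrite (iota_monomialX _ _ (esym bal)) scalerA [mnm_add l _]addmC addmK.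
have E i : (falling_poly k (r i) 0).[(m i)%:R] = ((m i) ^_ (r i))%:R.
  by apply: falling_poly_nat; rewrite addr0.
have [le|/[dup] nle] := boolP (lem r m); last first.
  rewrite -ffactm_eq0 => /eqP->; rewrite mul0r scale0r.
  move: nle => /forallPn[i]; rewrite -ltnNge => lt.
  by rewrite (bigD1 i) //= hornerM E ffact_small // !mul0r scale0r.
rewrite [mnm_add r _]addmC submK //; congr (_ *: _).
rewrite -natrM /ffactm -big_split natr_prod; apply: eq_bigr => i _.
rewrite hornerM E natrM mnmDE mnmBE; congr (_ * _); symmetry; apply: falling_poly_nat.
rewrite intrB -!pmulrn natrD natrB ?(forallP le) // addrCA. exact: addrC.
Qed.

(** A common part [d] of the two exponents can be pulled out to the left as a polynomial in the
    [theta i]. The shift by [- l i] appears because these act after [T l r], where [theta i] has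
    eigenvalue m_i - r_i + l_i. *)
Lemma monomial_op_factor l r d : wt w l = wt w r ->
  T (mnm_add l d) (mnm_add r d) =
  theta_prod (fun i => falling_poly k (d i) (- (l i)%:Z)) * T l r.
Proof.
move=> bal; apply: (iota_ext iota_inj) => m.
have bal' : wt w (mnm_add l d) = wt w (mnm_add r d) by rewrite !wtD bal.
rewrite iotaME (iota_monomialX _ _ bal) iotaZE iota_theta_prodX (iota_monomialX _ _ bal') scalerA.
have [le|nle] := boolP (lem r m); last first.
  have := nle; rewrite -ffactm_eq0 => /eqP->; rewrite mul0r scale0r.
  suff : ~~ lem (mnm_add r d) m by rewrite -ffactm_eq0 => /eqP->; rewrite scale0r.
  by apply: contra nle; apply: lepm_trans; exact: lem_addr.
have cE : (ffactm m (mnm_add r d))%:R = (ffactm m r)%:R *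
   \prod_i (falling_poly k (d i) (- (l i)%:Z)).[(mnm_add l (mnm_sub m r) i)%:R].
  rewrite /ffactm !natr_prod -big_split; apply: eq_bigr => i _ /=.
  rewrite (@falling_poly_nat _ _ _ _ (m i - r i)%N).
    by rewrite -natrM mnmDE ffactnD.
  by rewrite mnmDE mnmBE intrN -pmulrn natrD addrAC subrr add0r.
rewrite cE; have [z|nz] := boolP (lem (mnm_add r d) m); last first.
  move: nz; rewrite -ffactm_eq0 => /eqP E; rewrite -cE E !scale0r //.
congr (_ *: mpolyX _ _); rewrite -submDA -addmA; congr mnm_add.
rewrite addmC submK //; apply/mnm_lepP => i; rewrite mnmBE.
by move/mnm_lepP: z => /(_ i); rewrite mnmDE => z; rewrite leq_subRL // (forallP le).
Qed.

Lemma monomial_op_power i j a b t : i != j -> (w i * a = w j * b)%N ->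
  T (mnm_muln (mnm1 i) a) (mnm_muln (mnm1 j) b) ^+ t =
  T (mnm_muln (mnm1 i) (a * t)) (mnm_muln (mnm1 j) (b * t)).
Proof.
move=> ij ab; have [qC pC pq] := canonical_pair_QP k n.
apply: iota_inj; rewrite rmorphXn /= !monomial_opE ?balancedE ?wt_mnm1n ?mulnA ?ab // /nu !nordX !mnmxl !mnmxr.
rewrite !mmap1_muln // !mmap1U !exprM exprMn_comm //.
by apply: commrX; apply: commr_sym; apply: commrX; rewrite /GRing.comm pq eq_sym (negPf ij) addr0.
Qed.

End BalancedRelations.

(** Lagrange interpolation of the constant 1: the difference of the two sides vanishes on [rs] and
    has degree less than its length. *)
Lemma lagrange_one (k : fieldType) (rs : seq k) : uniq rs -> rs != [::] ->
  \sum_(c <- rs) (\prod_(c' <- rs | c' != c) (c - c'))^-1 *: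
     \prod_(c' <- rs | c' != c) ('X - c'%:P) = 1.
Proof.
move=> urs rs0; apply/eqP; rewrite -subr_eq0; apply/eqP.
apply: (@roots_geq_poly_eq0 _ _ rs) => //.
  apply/allP => x xrs; rewrite rootE hornerD hornerN hornerC horner_sum subr_eq0.
  rewrite (bigD1_seq x) //= [X in _ + X == _]big1 ?addr0 => [|c cx].
    rewrite hornerZ horner_prod.
    have -> : \prod_(c' <- rs | c' != x) ('X - c'%:P).[x] = \prod_(c' <- rs | c' != x) (x - c').
      by apply: eq_bigr => c' _; rewrite !hornerE.
    by rewrite mulVf // prodf_seq_neq0; apply/allP => c' _; apply/implyP; rewrite subr_eq0 eq_sym.
  rewrite hornerZ horner_prod.
  have -> : \prod_(c' <- rs | c' != c) ('X - c'%:P).[x] = 0; last by rewrite mulr0.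
  by rewrite (big_rem x) //= eq_sym cx !hornerE subrr mul0r.
apply: leq_trans (size_polyD _ _) _; rewrite geq_max size_polyN size_poly1 lt0n size_eq0 rs0 andbT.
apply: leq_trans (size_sum _ _ _) _; apply/bigmax_leqP_seq => c crs _.
apply: leq_trans (size_scale_leq _ _) _.
rewrite -big_filter size_prod_XsubC -(rem_filter _ urs) size_rem // prednK //.
by case: (rs) crs.
Qed.

(** Evaluating [lagrange_one] at [h] writes [v] as a combination of its eigencomponents. If [rs] is
    empty, [ann] says that 1 acts as zero, so [v] is 0. *)
Lemma mem_of_eigencomponents (k : fieldType) (A : algType k) (M : lmodType A) (h : A) (rs : seq k)
    (N : {pred M}) (v : M) :
  uniq rs -> annihilates (horner_alg h (\prod_(c <- rs) ('X - c%:P))) M ->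
  GRing.submod_closed N ->
  (forall c, c \in rs -> horner_alg h (\prod_(c' <- rs | c' != c) ('X - c'%:P)) *: v \in N) ->
  v \in N.
Proof.
move=> urs ann [N0 NL] H; have [E|rs0] := eqVneq rs [::].
  by move: (ann v); rewrite E big_nil rmorph1 scale1r => ->.
rewrite -[v]scale1r -(rmorph1 (horner_alg h)) -(lagrange_one urs rs0) raddf_sum /= scaler_suml big_seq.
apply: (big_ind (fun x => x \in N)) => // [x y xN yN|c crs].
  by rewrite -[x]scale1r; apply: NL.
rewrite -mul_polyC rmorphM /= horner_algC -scalerA -[_ *: _]addr0; apply: NL => //; exact: H.
Qed.

Lemma horner_alg_comm (k : fieldType) (A : algType k) (a b : A) (p q : {poly k}) :
  a * b = b * a -> horner_alg a p * horner_alg b q = horner_alg b q * horner_alg a p.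
Proof.
move=> ab; apply: horner_alg_intertwine; symmetry; apply: horner_alg_intertwine.
by symmetry.
Qed.

(** * Relations on a finite dimensional module *)

Section FiniteDimensionalModules.
Variables (k : closedFieldType) (n : nat) (w : 'I_n -> nat).
Hypothesis char0 : [pchar k] =i pred0.
Hypothesis w_gt0 : forall i, (0 < w i)%N.
Hypothesis n_gt1 : (1 < n)%N.
Variables (A : algType k) (iota : {lrmorphism A -> polyend k n}).
Hypothesis iota_inj : injective iota.
Hypothesis iota_image : forall f, (exists a, iota a = f) <->
  exists P, (forall m, m \in msupp P -> balanced w m) /\ nu P = f.
Variable M : lmodType A.
Hypothesis M_fd : @finite_dimensional k A M.
Implicit Types (mm : multinom (n + n)) (m l r d : multinom n) (i j : 'I_n).

Local Notation T l r := (monomial_op iota_image (mnmx l r)).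
Local Notation theta := (theta iota_image).

(* With [x] the operator [Q_i^(w j * t) P_j^(w i * t)], which is zero on [M] for
   [t] large, and [y] its transpose, [y x] is a product of a falling factorial
   in [theta j] and a rising factorial in [theta i]. *)
Lemma falling_product_annihilates i j : i != j -> exists a b : nat,
  annihilates (horner_alg (theta j) (falling_poly k a 0) *
               horner_alg (theta i) (falling_poly k b b)) M.
Proof.
move=> ij; pose l t := mnm_muln (mnm1 i) (w j * t); pose r t := mnm_muln (mnm1 j) (w i * t).
have li t : l t i = (w j * t)%N by rewrite mulmnE mnm1E eqxx mul1n.
have ri t : r t i = 0%N by rewrite mulmnE mnm1E eq_sym (negPf ij).
have lj t : l t j = 0%N by rewrite mulmnE mnm1E (negPf ij).
have rj t : r t j = (w i * t)%N by rewrite mulmnE mnm1E eqxx mul1n.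
have lo t i' : i' != i -> l t i' = 0%N.
  by move=> ne; rewrite mulmnE mnm1E eq_sym (negPf ne).
have ro t i' : i' != j -> r t i' = 0%N.
  by move=> ne; rewrite mulmnE mnm1E eq_sym (negPf ne).
have bal t : wt w (l t) = wt w (r t).
  rewrite /wt (bigD1 i) //= big1 ?addn0 => [|i' ne]; last by rewrite lo ?muln0.
  rewrite (bigD1 j) //= big1 ?addn0 => [|i' ne]; last by rewrite ro ?muln0.
  by rewrite li rj mulnCA.
have c0 : (w j)%:Z%:~R != 0 :> k by rewrite -pmulrn pchar0_natf_eq0 // -lt0n.
have := theta_monomial iota_inj iota_image i (bal 1%N); rewrite li ri subr0 muln1.
case/(ladder_operator_nilpotent char0 c0 M_fd) => t _ xt.
exists (w i * t)%N, (w j * t)%N.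
have xt' : annihilates (T (l t) (r t)) M.
  have := monomial_op_power iota_inj iota_image t ij (mulnC (w i) (w j)).
  by rewrite -/(l t) -/(r t) => <-; move: xt; rewrite /l /r !muln1.
suff -> : horner_alg (theta j) (falling_poly k (w i * t) 0) *
   horner_alg (theta i) (falling_poly k (w j * t) (w j * t)%N) = T (r t) (l t) * T (l t) (r t).
  exact: annihilatesM_l.
rewrite (lowering_raising iota_inj iota_image (bal t)); apply: (iota_ext iota_inj) => m.
rewrite iota_theta_prodX iotaME !(iota_horner_thetaX, iotaZE) scalerA; congr (_ *: _).
have ff0 (s : int) (x : k) : (falling_poly k 0 s).[x] = 1.
  by rewrite horner_falling_poly big_ord0.
rewrite (bigD1 i) //= (bigD1 j) ?(eq_sym j) //= big1 ?mulr1 => [|i' /andP[ne ne']].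
  by rewrite !hornerM li ri lj rj !ff0 mul1r mulr1 subr0.
by rewrite hornerM lo // ro // !ff0 mulr1.
Qed.

(* In the relations for [(i, j)] and [(j, i)], the factors in [theta i] have
   negative roots in one and nonnegative roots in the other, so a Bezout relation
   eliminates [theta i]. *)
Lemma theta_annihilating_roots j : exists2 rs : seq int, uniq rs &
  annihilates (horner_alg (theta j) (\prod_(c <- rs) ('X - c%:~R%:P))) M.
Proof.
have [i ij] : exists i, i != j.
  have [->|ne] := eqVneq j (Ordinal (ltnW n_gt1)); [exists (Ordinal n_gt1) | exists (Ordinal (ltnW n_gt1))] => //.
  by rewrite eq_sym.
have [a [b H1]] := falling_product_annihilates ij.
have ji : j != i by rewrite eq_sym.
have [a' [b' H2]] := falling_product_annihilates ji.
(* These are the roots 0, ..., a - 1 of [f] and -b', ..., -1 of [g']: all distinct, so that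
   [theta j] will be diagonalisable. *)
exists ([seq Posz u | u <- seq.iota 0 a] ++ [seq Posz u - Posz b' | u <- seq.iota 0 b']).
  rewrite cat_uniq !map_inj_uniq ?iota_uniq //=; last 2 first.
  - by move=> x y /addIr [].
  - by move=> x y [].
  rewrite andbT; apply/hasPn => z /mapP[u]; rewrite mem_iota => /= ub ->.
  by apply/negP => /mapP[u' _]; lia.
have fallE c s : falling_poly k c s = \prod_(u <- seq.iota 0 c) ('X - (Posz u - s)%:~R%:P).
  by rewrite /falling_poly -(big_mkord xpredT (fun u => 'X - (Posz u - s)%:~R%:P)) /index_iota subn0.
rewrite big_cat !big_map /= -fallE.
have -> : \prod_(u <- seq.iota 0 a) ('X - (Posz u)%:~R%:P) = falling_poly k a 0.
  by rewrite fallE; apply: eq_bigr => u _; rewrite subr0.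
set f := falling_poly k a 0 in H1 *; set g := falling_poly k b b in H1.
set f' := falling_poly k a' 0 in H2; set g' := falling_poly k b' b' in H2 *.
have cop : coprimep g f'.
  apply: Pdiv.ClosedField.root_coprimep => x /rootP gx; apply/negP => /eqP f'x.
  have [u ub xE] := falling_poly_root_exists gx.
  by move: f'x; rewrite xE => /(falling_poly_root char0)[u' _]; lia.
have [[u v] /= uv] := Bezout_eq1_coprimepP _ _ cop.
have C p q := horner_alg_comm p q (theta_comm iota_inj iota_image j i).
rewrite -[horner_alg _ _]mulr1 -(rmorph1 (horner_alg (theta i))) -uv rmorphD mulrDr.
apply: annihilatesD.
  rewrite [f * g']mulrC [u * g]mulrC !rmorphM /= -!mulrA; apply: annihilatesM_l.
  by rewrite mulrA; apply: annihilatesM_r.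
rewrite [v * f']mulrC !rmorphM /= -!mulrA; apply: annihilatesM_l.
by rewrite mulrA C; apply: annihilatesM_r.
Qed.

End FiniteDimensionalModules.

Lemma alg_scale_eq0 (k : fieldType) (A : algType k) (M : lmodType A) (c : k) (v : M) :
  (c%:A *: v == 0) = (c == 0) || (v == 0).
Proof.
have [->|c0] := eqVneq c 0; first by rewrite !scale0r eqxx.
apply/eqP/eqP => [cv|->]; last by rewrite scaler0.
by rewrite -[v]scale1r -[1](scale1r (1 : A)) -(mulVf c0) -algM -scalerA cv scaler0.
Qed.

(** * Joint eigenvectors and the modules they generate *)

Section WeightVectors.
Variables (k : closedFieldType) (n : nat) (w : 'I_n -> nat).
Hypothesis char0 : [pchar k] =i pred0.
Hypothesis w_gt0 : forall i, (0 < w i)%N.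
Hypothesis n_gt1 : (1 < n)%N.
Variables (A : algType k) (iota : {lrmorphism A -> polyend k n}).
Hypothesis iota_inj : injective iota.
Hypothesis iota_image : forall f, (exists a, iota a = f) <->
  exists P, (forall m, m \in msupp P -> balanced w m) /\ nu P = f.
Variable M : lmodType A.
Hypothesis M_fd : @finite_dimensional k A M.
Implicit Types (mm : multinom (n + n)) (m l r d : multinom n) (i j : 'I_n).

Local Notation T l r := (monomial_op iota_image (mnmx l r)).
Local Notation theta := (theta iota_image).

Definition weight_vector (lam : 'I_n -> int) (v : M) :=
  forall i, theta i *: v = (lam i)%:~R%:A *: v.

(** In the product relation applied to [v], the factor in [theta i] has only negative roots. If
    [lam i] is nonnegative, [lam j] must then be a root of the factor in [theta j], whose roots are
    nonnegative. *)
Lemma weight_sign lam v i j : v != 0 -> weight_vector lam v -> (0 <= lam i) = (0 <= lam j).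
Proof.
move=> v0 vlam.
have half i' j' : i' != j' -> 0 <= lam i' -> 0 <= lam j'.
  move=> /(falling_product_annihilates char0 w_gt0 iota_inj iota_image M_fd)[a [b H]] lami.
  have := H v; rewrite -scalerA (horner_alg_eigenvector _ (vlam i')).
  rewrite scalerA alg_mulC -scalerA (horner_alg_eigenvector _ (vlam j')) scalerA algM => /eqP.
  rewrite alg_scale_eq0 (negPf v0) orbF mulf_eq0 => /orP[] /eqP /(falling_poly_root char0)[u]; lia.
have [->//|ne] := eqVneq i j; apply/idP/idP; apply: half => //.
by rewrite eq_sym.
Qed.

Definition generates (s : seq M) := forall N : {pred M}, GRing.submod_closed N ->
  (forall v, v \in s -> v \in N) -> forall x, x \in N.

(** The generators are split into eigencomponents for one [theta i] after another. The [theta i]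
    commute, so earlier eigenvector properties survive. *)
Lemma weight_generators : exists2 s : seq M, generates s &
  forall v, v \in s -> exists lam, weight_vector lam v.
Proof.
suff [s gs Hs] : exists2 s : seq M, generates s &
    forall v, v \in s -> forall i, i \in enum 'I_n -> exists c : int, theta i *: v = c%:~R%:A *: v.
  exists s => // v vs.
  have H i : exists c : int, theta i *: v = c%:~R%:A *: v by apply: Hs; rewrite // mem_enum.
  by have [lam lamP] := choice H; exists lam.
elim: (enum _) => [|i L [s gs Hs]].
  have [d [e eP]] := M_fd; exists [seq e u | u <- enum 'I_d] => // N [N0 NL] HN x.
  have [c ->] := eP x; apply: (big_ind (fun y => y \in N)) => // [y z yN zN|u _].
    by rewrite -[y]scale1r; apply: NL.
  by rewrite -[_ *: _]addr0; apply: NL => //; apply: HN; apply: map_f; rewrite mem_enum.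
have [rs urs ann] := theta_annihilating_roots char0 w_gt0 n_gt1 iota_inj iota_image M_fd i.
pose ks : seq k := [seq c%:~R | c : int <- rs].
have uks : uniq ks by rewrite map_inj_uniq //; exact: intr_inj0.
have annk : annihilates (horner_alg (theta i) (\prod_(c <- ks) ('X - c%:P))) M.
  by rewrite /ks big_map.
pose h c := horner_alg (theta i) (\prod_(c' <- ks | c' != c) ('X - c'%:P)).
exists [seq h c *: v | v <- s, c <- ks].
  move=> N Ncl HN; apply: gs => // v vs; apply: (mem_of_eigencomponents uks annk) => // c cks.
  by apply: HN; apply/allpairsP; exists (v, c).
move=> _ /allpairsP[[v c] /= [vs cks ->]] j; rewrite inE => /predU1P[->|jL].
  have /mapP[z zrs cE] := cks; exists z; rewrite -cE.
  have E : theta i - c%:A = horner_alg (theta i) ('X - c%:P).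
    by rewrite rmorphB /= horner_algX horner_algC.
  apply/eqP; rewrite -subr_eq0 -scalerBl E scalerA /h -rmorphM /=; apply/eqP.
  by rewrite -(bigD1_seq c) //; apply: annk.
have [z zE] := Hs v vs j jL; exists z.
rewrite scalerA -(horner_alg_intertwine _ (theta_comm iota_inj iota_image i j)) -scalerA zE.
by rewrite [LHS]scalerA alg_mulC -[LHS]scalerA.
Qed.


Lemma theta_prod_weight lam v f : weight_vector lam v ->
  theta_prod iota_image f *: v = (\prod_i (f i).[(lam i)%:~R])%:A *: v.
Proof.
move=> vlam; rewrite /theta_prod; elim: index_enum => [|i s IH].
  by rewrite !big_nil !scale1r.
rewrite !big_cons -[LHS]scalerA IH [LHS]scalerA alg_mulC -[LHS]scalerA.
by rewrite (horner_alg_eigenvector _ (vlam i)) [LHS]scalerA algM mulrC.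
Qed.

Lemma monomial_weight lam v l r : wt w l = wt w r -> weight_vector lam v ->
  weight_vector (fun i => lam i + (l i)%:Z - (r i)%:Z) (T l r *: v).
Proof.
move=> bal vlam i; rewrite scalerA (theta_monomial iota_inj) // -[LHS]scalerA.
by rewrite scalerDl vlam -!scalerDl -intrD addrA [LHS]scalerA alg_mulC -[LHS]scalerA.
Qed.

Lemma weightZ lam v c : weight_vector lam v -> weight_vector lam (c%:A *: v).
Proof. by move=> vlam i; rewrite [LHS]scalerA alg_mulC -[LHS]scalerA vlam [LHS]scalerA [RHS]scalerA !algM mulrC. Qed.

(** The product, over the weights [mu'] in [ms] other than [mu], of the factors (theta i - mu' i) /
    (mu i - mu' i), where [i] is a coordinate at which the two weights differ. *)
Lemma weight_projector (ms : seq {ffun 'I_n -> int}) (mu : {ffun 'I_n -> int}) :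
  exists b : A, (forall u, weight_vector mu u -> b *: u = u) /\
    forall mu' u, mu' \in ms -> mu' != mu -> weight_vector mu' u -> b *: u = 0.
Proof.
elim: ms => [|mu' ms [b [b1 b0]]].
  by exists 1; split=> // u _; rewrite scale1r.
have [E|ne] := eqVneq mu' mu.
  exists b; split=> // nu' u; rewrite inE => /predU1P[->|]; first by rewrite E eqxx.
  exact: b0.
have [i mui] : exists i, mu' i != mu i.
  apply/existsP; apply: contraNT ne => /existsPn ne; apply/eqP/ffunP => i.
  by apply/eqP; have := ne i; rewrite negbK.
pose z : k := (mu i)%:~R - (mu' i)%:~R.
have z0 : z != 0 by rewrite subr_eq0; apply: contra mui => /eqP/(intr_inj0 char0)->.
pose t := theta i - (mu' i)%:~R%:A.
have tE lam u : weight_vector lam u -> t *: u = ((lam i)%:~R - (mu' i)%:~R)%:A *: u.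
  by move=> ulam; rewrite scalerBl ulam -scalerBl -scalerBl.
exists (b * (z^-1%:A * t)); split=> [u umu|lam u].
  by rewrite -!scalerA (tE _ _ umu) -/z [z^-1%:A *: _]scalerA algM mulVf // scale1r scale1r b1.
rewrite inE => lamms lamne ulam.
have := tE _ _ ulam; case/predU1P: lamms => [->|lams] tu.
  by rewrite -!scalerA tu subrr scale0r scale0r !scaler0.
by rewrite -!scalerA tu [z^-1%:A *: _]scalerA algM [LHS]scalerA alg_mulC -[LHS]scalerA (b0 lam) ?scaler0.
Qed.

Lemma operator_expansion a : exists2 s : seq (multinom (n + n)),
  (forall mm, mm \in s -> balanced w mm) &
  exists c : multinom (n + n) -> k, a = \sum_(mm <- s) (c mm)%:A * monomial_op iota_image mm.
Proof.
exists (msupp (symbol iota_image a)); first exact: symbol_balanced.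
exists (fun mm => mcoeff mm (symbol iota_image a)); apply: iota_inj.
rewrite -(nu_symbol iota_image a) [in LHS](mpolyE (symbol iota_image a)) linear_sum raddf_sum.
rewrite big_seq [RHS]big_seq; apply: eq_bigr => mm /symbol_balanced bal.
by rewrite linearZ /= mulr_algl linearZ /= monomial_opE.
Qed.

(** Applied to a weight, the sum is the eigenvalue of the central element, so the sign of that
    eigenvalue recovers the common sign of the coordinates. *)
Lemma sum_weight_ge0 (lam : 'I_n -> int) i :
  (forall j, (0 <= lam i) = (0 <= lam j)) ->
  (0 <= lam i) = (0 <= \sum_j (w j)%:Z * lam j).
Proof.
move=> sg; case: (boolP (0 <= lam i)) => [ge|lt].
  by symmetry; apply: sumr_ge0 => j _; rewrite mulr_ge0 // -sg.
symmetry; apply/negbTE; rewrite -ltNge -oppr_gt0 -sumrN (bigD1 i) //=.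
have neg j : lam j < 0 by rewrite ltNge -sg.
rewrite ltr_wpDr //; first by apply: sumr_ge0 => j _; rewrite -mulrN mulr_ge0 // oppr_ge0 ltW.
by rewrite -mulrN mulr_gt0 ?oppr_gt0 // ltz_nat.
Qed.

(** A nonzero weight component of [a *: v], of weight [mu], is a multiple of [y], the image of [v]
    under the smallest monomial that shifts [lam] to [mu]. The transposed monomial sends [y] back to
    a multiple of [v], nonzero because [lam] and [mu] have the same sign. *)
Lemma weight_vector_simple lam v a : weight_vector lam v -> a *: v != 0 ->
  exists b : A, b *: (a *: v) = v.
Proof.
move=> vlam av0; have v0 : v != 0 by apply: contraNneq av0 => ->; rewrite scaler0.
have [s sbal [c aE]] := operator_expansion a.
pose wtm mm : {ffun 'I_n -> int} := [ffun i => lam i + (mnml mm i)%:Z - (mnmr mm i)%:Z].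
pose u mm := (c mm)%:A *: (monomial_op iota_image mm *: v).
have auE : a *: v = \sum_(mm <- s) u mm.
  by rewrite aE scaler_suml; apply: eq_bigr => mm _; rewrite -scalerA.
have uwt mm : mm \in s -> weight_vector (wtm mm) (u mm).
  move=> /sbal /eqP bal; apply: weightZ => i.
  by have := monomial_weight bal vlam i; rewrite mnmxK ffunE.
pose ms := undup [seq wtm mm | mm <- s].
have [b bP] := choice (weight_projector ms).
have bu mu mm : mm \in s -> b mu *: u mm = if wtm mm == mu then u mm else 0.
  move=> mms; have [b1 b0] := bP mu; case: eqVneq => [E|ne].
    by apply: b1; rewrite -E; apply: uwt.
  by apply: (b0 (wtm mm)) => //; [rewrite mem_undup map_f | apply: uwt].
(* [a *: v] is the sum of its projections to the weights in [ms], so one of them is nonzero. *)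
have [mu muP] : exists mu, b mu *: (a *: v) != 0.
  apply: contrapT => nex; case/eqP: av0.
  have -> : a *: v = \sum_(mu <- ms) b mu *: (a *: v).
    under eq_bigr => mu _ do rewrite auE scaler_sumr.
    rewrite auE exchange_big big_seq [RHS]big_seq /=; apply: eq_bigr => mm mms.
    rewrite (bigD1_seq (wtm mm)) ?undup_uniq ?mem_undup ?map_f //= bu // eqxx big1 ?addr0 //.
    by move=> mu ne; rewrite bu // eq_sym (negPf ne).
  apply: big1 => mu _; apply/eqP; apply: contrapT => /negP ne; apply: nex; by exists mu.
have bmuE : b mu *: (a *: v) = \sum_(mm <- s | wtm mm == mu) u mm.
  rewrite auE scaler_sumr big_seq [RHS]big_mkcond [RHS]big_seq.
  by apply: eq_bigr => mm; apply: bu.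
have [mm0 mm0s mm0E] : exists2 mm, mm \in s & wtm mm = mu.
  apply: contrapT => nex; case/eqP: muP; rewrite bmuE big_seq_cond big1 // => mm /andP[mms /eqP E].
  by case: nex; exists mm.
(* The positive and negative parts of [mu - lam], which have disjoint supports. Every monomial
   inducing this shift has exponents [al + d] and [be + d] for some [d]. *)
pose al := mnm_sub (mnml mm0) (mnmr mm0); pose be := mnm_sub (mnmr mm0) (mnml mm0).
have alE i : (al i)%:Z - (be i)%:Z = mu i - lam i.
  rewrite -mm0E ffunE !mnmBE; lia.
have disj i : al i = 0%N \/ be i = 0%N.
  rewrite !mnmBE; lia.
clearbody al be.
have factor mm : mm \in s -> wtm mm = mu ->
    wt w al = wt w be /\ exists d, mnml mm = mnm_add al d /\ mnmr mm = mnm_add be d.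
  move=> mms mE; pose d := mnm_sub (mnml mm) al.
  have E i : (mnml mm i)%:Z - (mnmr mm i)%:Z = mu i - lam i by rewrite -mE ffunE; lia.
  have lE : mnml mm = mnm_add al d.
    apply/mnmP => i; rewrite mnmDE mnmBE; have := E i; have := alE i; have := disj i; lia.
  have rE : mnmr mm = mnm_add be d.
    apply/mnmP => i; rewrite mnmDE mnmBE; have := E i; have := alE i; have := disj i; lia.
  split; last by exists d.
  have /eqP := sbal mm mms; rewrite lE rE !wtD; lia.
have [bal _] := factor _ mm0s mm0E.
pose y := T al be *: v.
have ymu : weight_vector mu y.
  move=> i; have := monomial_weight bal vlam i; rewrite -/y => ->.
  by have := alE i => E; rewrite (_ : lam i + _ - _ = mu i) //; lia.
have [e eE] : exists e : k, b mu *: (a *: v) = e%:A *: y.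
  rewrite bmuE big_seq_cond; apply: (big_ind (fun x => exists e : k, x = e%:A *: y)).
  - by exists 0; rewrite scale0r scale0r.
  - by move=> _ _ [e1 ->] [e2 ->]; exists (e1 + e2); rewrite !scalerDl.
  - move=> mm /andP[mms /eqP mE]; have [_ [d [lE rE]]] := factor mm mms mE.
    exists (c mm * \prod_i (falling_poly k (d i) (- (al i)%:Z)).[(mu i)%:~R]).
    rewrite /u -{2}(mnmxK mm) lE rE (monomial_op_factor iota_inj) // -[in LHS]scalerA -/y.
    by rewrite (theta_prod_weight _ ymu) scalerA algM.
have e0 : e != 0 by apply: contraNneq muP => E; rewrite eE E scale0r scale0r.
have y0 : y != 0 by apply: contraNneq muP => E; rewrite eE E scaler0.
have := lowering_raising iota_inj iota_image bal.
set f := (X in theta_prod _ X) => TT.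
pose ka := \prod_i (f i).[(lam i)%:~R].
have TyE : T be al *: y = ka%:A *: v by rewrite scalerA TT (theta_prod_weight _ vlam).
(* The central element has the same eigenvalue on [v] and on [y], by the balance of [al] and [be];
   hence the signs of [lam] and [mu] agree. *)
have wE : \sum_j (w j)%:Z * lam j = \sum_j (w j)%:Z * mu j.
  apply/eqP; rewrite eq_sym -subr_eq0 -sumrB; apply/eqP.
  rewrite (eq_bigr (fun j => (w j * al j)%N%:Z - (w j * be j)%N%:Z)) => [|j _]; last first.
    by have := alE j; rewrite !PoszM; lia.
  by rewrite sumrB -!(big_morph Posz PoszD (erefl _)) -!/(wt w _) bal subrr.
have pos i : (0 <= lam i) = (0 <= mu i).
  rewrite (sum_weight_ge0 (fun j => weight_sign i j v0 vlam)) wE.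
  by rewrite -(sum_weight_ge0 (fun j => weight_sign i j y0 ymu)).
(* A vanishing factor would need 0 <= lam i < be i, whence mu i < 0, or - al i <= lam i < 0, whence
   mu i >= 0. Either contradicts [pos]. *)
have ka0 : ka != 0.
  apply/prodf_neq0 => i _; rewrite /f hornerM mulf_neq0 //; apply/negP => /eqP/(falling_poly_root char0)[x xa].
    by have := pos i; have := alE i; have := disj i; lia.
  by have := pos i; have := alE i; have := disj i; lia.
exists ((e * ka)^-1%:A * T be al * b mu).
rewrite -[LHS]scalerA eE -[LHS]scalerA [T be al *: _]scalerA alg_mulC.
rewrite -[e%:A * _ *: _]scalerA TyE [e%:A *: _]scalerA algM [LHS]scalerA algM.
by rewrite mulVf ?mulf_neq0 // !scale1r.
Qed.

Lemma balanced_completely_reducible : completely_reducible M.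
Proof.
have [s gs Hs] := weight_generators.
apply: (completely_reducible_simple_generators _ gs) => v vs a.
by have [lam vlam] := Hs v vs; apply: weight_vector_simple.
Qed.

End WeightVectors.

(** * Gelfand-Kirillov dimension *)

Section LimsupOfGrowth.
Variable R : realType.
Implicit Types (u : nat -> \bar R) (v : nat -> nat).

Lemma limn_esup_le_eventually u (l : \bar R) N :
  (forall m, (N <= m)%N -> u m <= l)%E -> (limn_esup u <= l)%E.
Proof.
move=> ul; apply: ge_ereal_inf; exists (ereal_sup (u @` [set m | (N <= m)%N]))%classic.
  by exists [set m | (N <= m)%N]%classic => //; exact: nbhs_infty_ge.
by apply: ge_ereal_sup => _ [m /= Nm <-]; exact: ul.
Qed.

Lemma limn_esup_ge_eventually u (l : \bar R) N :
  (forall m, (N <= m)%N -> l <= u m)%E -> (l <= limn_esup u)%E.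
Proof.
move=> lu; apply: le_ereal_inf_tmp => _ [V [N' _ NV] <-].
apply: le_ereal_sup_tmp; exists (u (maxn N N')); last by apply: lu; exact: leq_maxl.
by exists (maxn N N') => //; apply: NV; exact: leq_maxr.
Qed.

Lemma ln_nat_unbounded (C : R) : exists N, forall m, (N <= m)%N -> C <= ln (m%:R : R).
Proof.
exists (Num.truncn (expR C)).+1 => m Nm.
have lt : expR C < m%:R by apply: lt_le_trans (truncnS_gt _) _; rewrite ler_nat.
rewrite -(expRK C) ler_ln ?posrE ?expR_gt0 //; first exact: ltW.
exact: lt_trans (expR_gt0 C) lt.
Qed.

(** After division by [ln m], the constant contributes N ln(C + 1) / ln m, which is at most [e] from
    [M] on. [C.+1] keeps the argument of the logarithm positive when [C] is 0. *)
Lemma limn_esup_growth_le v N C :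
  (forall m, (0 < m)%N -> (v m <= (C * m) ^ N)%N) ->
  (limn_esup (fun m => (ln ((v m)%:R : R) / ln m%:R)%:E) <= (N%:R)%:E)%E.
Proof.
move=> vle; apply/lee_addgt0Pr => e e0.
have [M HM] := ln_nat_unbounded (Num.max 1 (N%:R * ln (C.+1%:R : R) / e)).
apply: (@limn_esup_le_eventually _ _ (maxn M 1)) => m; rewrite geq_max => /andP[Mm m0].
have := HM m Mm; rewrite ge_max => /andP[lm1 lmC].
have lm0 : 0 < ln (m%:R : R) by apply: lt_le_trans lm1.
rewrite -EFinD lee_fin ler_pdivrMr // mulrDl.
have CC : 0 <= ln (C.+1%:R : R) by apply: ln_ge0; rewrite ler1n.
(* If [v m] is 0, its logarithm is 0 by convention. *)
have [v0|v0] := posnP (v m).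
  by rewrite v0 ln0 // addr_ge0 // mulr_ge0 // ltW.
apply: (@le_trans _ _ (ln ((C.+1 * m) ^ N)%N%:R)).
  rewrite ler_ln ?posrE ?ltr0n ?expn_gt0 ?muln_gt0 ?m0 // ler_nat.
  by apply: leq_trans (vle m m0) _; case: (N) => // N'; rewrite leq_exp2r // leq_mul2r leqnSn orbT.
rewrite natrX lnXn ?ltr0n ?muln_gt0 ?m0 // natrM lnM ?posrE ?ltr0n //.
rewrite mulrnDl -[ln C.+1%:R *+ N]mulr_natl -[ln m%:R *+ N]mulr_natl addrC lerD2l.
by rewrite [e * _]mulrC -ler_pdivrMr.
Qed.

Lemma limn_esup_growth_ge v N D : (0 < D)%N ->
  (forall m, (0 < m)%N -> (m ^ N <= D * v m)%N) ->
  ((N%:R)%:E <= limn_esup (fun m => (ln ((v m)%:R : R) / ln m%:R)%:E))%E.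
Proof.
move=> D0 vge; apply/lee_subgt0Pr => e e0.
have [M HM] := ln_nat_unbounded (Num.max 1 (ln (D%:R : R) / e)).
apply: (@limn_esup_ge_eventually _ _ (maxn M 1)) => m; rewrite geq_max => /andP[Mm m0].
have := HM m Mm; rewrite ge_max => /andP[lm1 lmC].
have lm0 : 0 < ln (m%:R : R) by apply: lt_le_trans lm1.
have v0 : (0 < v m)%N.
  by move: (vge m m0); case: (v m) => //; rewrite muln0 leqn0 expn_eq0 eqn0Ngt m0.
rewrite -EFinB lee_fin ler_pdivlMr // mulrBl lerBlDr.
apply: (@le_trans _ _ (ln (D * v m)%N%:R)).
  rewrite mulr_natl -lnXn ?ltr0n // -natrX ler_ln ?posrE ?ltr0n ?expn_gt0 ?muln_gt0 ?m0 ?D0 //.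
  by rewrite ler_nat vge.
rewrite natrM lnM ?posrE ?ltr0n // addrC lerD2l.
by rewrite [e * _]mulrC -ler_pdivrMr.
Qed.

End LimsupOfGrowth.

(** * Bounds for the dimension of a span *)

Section DimSpan.
Variables (k : fieldType) (V : lmodType k).

(** The coefficient matrix of an independent subfamily has independent rows, so it has at most as
    many rows as columns. *)
Lemma dim_span_le (s : seq V) (J : finType) (B : {set J}) (e : J -> V) :
  (forall x, x \in s -> exists c : J -> k, x = \sum_(j in B) c j *: e j) ->
  (Defs.dim_span s <= #|B|)%N.
Proof.
move=> H; apply/bigmax_leqP => I /asboolP free.
have H' (i : 'I_(size s)) : exists c : J -> k, s`_i = \sum_(j in B) c j *: e j.
  by apply: H; apply: mem_nth.
have [C CP] := choice H'.
pose M : 'M[k]_(#|I|, #|B|) := \matrix_(i, j) C (enum_val i) (enum_val j).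
suff : row_free M by rewrite /row_free => /eqP <-; exact: rank_leq_col.
apply: inj_row_free => v vM.
(* The row vector [v] extended by 0 to all indices of [s]: the sum has one term for [i] in [I], and
   none otherwise. *)
pose c i := \sum_(a < #|I| | enum_val a == i) v 0 a.
have cE a : c (enum_val a) = v 0 a.
  rewrite /c (big_pred1 a) // => b; apply/eqP/eqP => [/enum_val_inj//|->//].
apply/rowP => a; rewrite mxE -cE; apply: free; last exact: enum_valP.
rewrite big_enum_val /=.
under eq_bigr => b _ do rewrite cE CP scaler_sumr.
rewrite exchange_big /= big1 // => j jB.
under eq_bigr => b _ do rewrite scalerA.
rewrite -scaler_suml; move/rowP/(_ (enum_rank_in jB j)): vM; rewrite !mxE.
under eq_bigr => b _ do rewrite mxE enum_rankK_in //.
by move=> ->; rewrite scale0r.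
Qed.

(** [dim_span] counts positions in the list, so the positions of the [f j] have to be distinct;
    freeness forces this, as two equal vectors would be dependent. *)
Lemma dim_span_ge (s : seq V) (J : finType) (f : J -> V) :
  (forall j, f j \in s) ->
  (forall c : J -> k, \sum_j c j *: f j = 0 -> forall j, c j = 0) ->
  (#|J| <= Defs.dim_span s)%N.
Proof.
move=> fs free; have lt j : (index (f j) s < size s)%N by rewrite index_mem.
pose g j := Ordinal (lt j).
have gE j : s`_(g j) = f j by rewrite nth_index.
have ginj : injective g.
  move=> i j gij; apply/eqP; apply: contraT => ne.
  have fij : f i = f j by rewrite -!gE gij.
  suff /free /(_ i) /eqP : \sum_l ((l == i)%:R - (l == j)%:R) *: f l = 0.
    by rewrite eqxx (negPf ne) subr0 oner_eq0.
  under eq_bigr => l _ do rewrite scalerBl.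
  rewrite sumrB (bigD1 i) //= [X in _ - X](bigD1 j) //= !eqxx !scale1r.
  by rewrite !big1 ?addr0 ?fij ?subrr // => l /negPf->; rewrite scale0r.
rewrite -(card_imset _ ginj) /Defs.dim_span.
apply: (@leq_bigmax_cond _ _ (fun I : {set 'I_(size s)} => #|I|) (g @: J)).
apply/asboolP => c; rewrite big_imset /=; last by move=> ? ? _ _; exact: ginj.
under eq_bigr => j _ do rewrite gE.
move=> E i /imsetP[j _ ->]; exact: (free (fun j => c (g j))).
Qed.

End DimSpan.

(** * Growth of algebras of balanced operators *)

Section GKdimension.
Variables (k : fieldType) (n : nat) (w : 'I_n -> nat).
Hypothesis char0 : [pchar k] =i pred0.
Hypothesis w_gt0 : forall i, (0 < w i)%N.
Variables (A : algType k) (iota : {lrmorphism A -> polyend k n}).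
Hypothesis iota_inj : injective iota.
Hypothesis iota_image : forall f, (exists a, iota a = f) <->
  exists P, (forall m, m \in msupp P -> balanced w m) /\ nu P = f.
Variable i0 : 'I_n.
Implicit Types (mm : multinom (n + n)) (m l r : multinom n).

Local Notation symbol := (symbol iota_image).
Local Notation mop := (monomial_op iota_image).

Lemma symbol_monomial_op mm : balanced w mm -> symbol (mop mm) = mpolyX k mm.
Proof. by move=> bal; apply: symbolE => //; rewrite monomial_opE. Qed.

Lemma bounded_expansion D x : (msize (symbol x) <= D.+1)%N ->
  exists c : bmultinom (n + n) D.+1 -> k,
    x = \sum_(mm in [set mm : bmultinom (n + n) D.+1 | balanced w mm]) c mm *: mop mm.
Proof.
move=> xD; exists (fun mm => mcoeff mm (symbol x)); apply: iota_inj.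
rewrite -(nu_symbol iota_image x) [in LHS](mpolywE xD) linear_sum raddf_sum /=.
rewrite (bigID (fun mm : bmultinom (n + n) D.+1 => balanced w mm)) /= [X in _ + X]big1 ?addr0.
  apply: eq_big => [mm|mm bal]; first by rewrite inE.
  by rewrite linearZ [in RHS]linearZ /= monomial_opE.
move=> mm nbal; rewrite memN_msupp_eq0 ?scale0r ?linear0 //.
by apply: contra nbal; exact: symbol_balanced.
Qed.

Lemma wt_D1 (m : multinom n) : wt w m = (w i0 * m i0 + \sum_(i | i != i0) w i * m i)%N.
Proof. by rewrite /wt (bigD1 i0). Qed.

(** Given the other coordinates, the balance equation determines the one at [lshift n i0], because
    [w i0] is positive. *)
Lemma card_balanced D :
  (#|[set mm : bmultinom (n + n) D.+1 | balanced w mm]| <= D.+1 ^ (2 * n - 1))%N.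
Proof.
pose X := {i : 'I_(n + n) | i != lshift n i0}.
have cX : #|{: X}| = (2 * n - 1)%N.
  rewrite card_sig (eq_card (B := predC1 (lshift n i0))) // cardC1 card_ord; lia.
have cF : #|{: {ffun X -> 'I_D.+1}}| = (D.+1 ^ (2 * n - 1))%N by rewrite card_ffun card_ord cX.
pose f (mm : bmultinom (n + n) D.+1) : {ffun X -> 'I_D.+1} := [ffun i => inord (bmnm mm (val i))].
rewrite -cF -(card_in_imset (f := f)) ?max_card // => mm mm'; rewrite !inE => bal bal' E.
have coord (i : 'I_(n + n)) : i != lshift n i0 -> bmnm mm i = bmnm mm' i.
  move=> ne; have := congr1 (fun g : {ffun X -> 'I_D.+1} => val (g (exist _ i ne))) E.
  have b (m' : bmultinom (n + n) D.+1) : (bmnm m' i < D.+1)%N.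
    by apply: leq_ltn_trans (bmdeg m'); rewrite mdegE (bigD1 i) //= leq_addr.
  by rewrite !ffunE /= !inordK.
apply: val_inj; apply/mnmP => i; have [->|] := eqVneq i (lshift n i0); last exact: coord.
move: bal bal'; rewrite /balanced !wt_D1.
have -> : mnmr (bmnm mm) i0 = mnmr (bmnm mm') i0 by rewrite !mnmrE coord // eq_rlshift.
have -> : (\sum_(i | i != i0) w i * mnmr (bmnm mm) i = \sum_(i | i != i0) w i * mnmr (bmnm mm') i)%N.
  by apply: eq_bigr => j _; rewrite !mnmrE coord // eq_rlshift.
have -> : (\sum_(i | i != i0) w i * mnml (bmnm mm) i = \sum_(i | i != i0) w i * mnml (bmnm mm') i)%N.
  by apply: eq_bigr => j ne; rewrite !mnmlE coord // eq_lshift.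
by move=> /eqP <- /eqP /addIn /eqP; rewrite eqn_pmul2l // !mnmlE => /eqP ->.
Qed.

Lemma msize_products (s : seq A) d t x : (forall y, y \in s -> (msize (symbol y) <= d.+1)%N) ->
  x \in products s t -> (msize (symbol x) <= (t * d).+1)%N.
Proof.
move=> sd; elim: t x => [|t IH] x /=.
  by rewrite inE => /eqP->; rewrite symbol1 // msize1.
move=> /allpairsP[[y z] /= [ys zj ->]]; have yd := sd _ ys; have zd := IH _ zj.
have [R Rs ->] := symbolM char0 yd zd.
rewrite mulSn; apply: msizeD_leq; last exact: leqW.
by rewrite -addnS; apply: msizeM_leq.
Qed.

Lemma dim_products_le (s : seq A) : exists C, forall t, (0 < t)%N ->
  (Defs.dim_span (products_upto s t) <= (C * t) ^ (2 * n - 1))%N.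
Proof.
have [d sd] : exists d, forall y, y \in s -> (msize (symbol y) <= d.+1)%N.
  exists (\max_(y <- s) msize (symbol y))%N => y ys; apply: leqW.
  by rewrite (big_rem y) //= leq_maxl.
(* For positive [t], the number [t * d + 1] is at most [d.+1 * t]. *)
exists d.+1 => t t0; pose D := (t * d)%N.
apply: (@leq_trans (D.+1 ^ (2 * n - 1))); last first.
  by case: (2 * n - 1)%N => // N; rewrite leq_exp2r // /D; nia.
apply: leq_trans (card_balanced D).
apply: (@dim_span_le k A _ _ _ (fun mm : bmultinom (n + n) D.+1 => mop mm)) => x.
move=> /flattenP[_ /mapP[j] + ->]; rewrite mem_iota add0n ltnS => /= jm xj.
apply: bounded_expansion; apply: leq_trans (msize_products sd xj) _.
by rewrite ltnS leq_mul2r jm orbT.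
Qed.


(** The correction [R] has degree less than the product of the symbols, so the leading term of that
    product survives. *)
Lemma lead_mul a b : a != 0 -> b != 0 -> a * b != 0 /\
  mlead (symbol (a * b)) = mnm_add (mlead (symbol a)) (mlead (symbol b)).
Proof.
move=> a0 b0; have p0 : symbol a != 0 by rewrite symbol_eq0.
have q0 : symbol b != 0 by rewrite symbol_eq0.
have [R Rs E] := symbolM char0 (eq_leq (msize_symbol char0 iota_inj iota_image a0))
  (eq_leq (msize_symbol char0 iota_inj iota_image b0)).
rewrite -mdegD -mleadM // in Rs.
have pq0 : symbol a * symbol b != 0 by rewrite mulf_neq0.
rewrite -(symbol_eq0 char0 iota_inj iota_image) E -mleadM //; have [->|R0] := eqVneq R 0.
  by rewrite addr0.
split; last by apply: mleadDl; apply: lt_mdeg_ltmc; rewrite -ltnS mlead_deg // ltnS.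
apply: contraTneq Rs => /eqP; rewrite addrC addr_eq0 => /eqP->.
by rewrite msizeN -mlead_deg // ltnn.
Qed.

Lemma free_of_leads (J : finType) (f : J -> A) : (forall j : J, f j != 0) ->
  injective (fun j : J => mlead (symbol (f j))) ->
  forall c : J -> k, \sum_(j : J) c j *: f j = 0 -> forall j : J, c j = 0.
Proof.
move=> f0 linj c E j0; apply/eqP; apply: contraT => cj0.
(* Among the indices with nonzero coefficient, take the one of largest leading exponent; no other
   term reaches that exponent. *)
case: (@Order.TotalTheory.arg_maxP _ _ J j0 (fun j : J => c j != 0) (fun j : J => mlead (symbol (f j))) cj0) => j cj jmax.
have sE : \sum_(j : J) c j *: symbol (f j) = 0.
  transitivity (symbol (\sum_(j : J) c j *: f j)); last by rewrite E symbol0.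
  apply: (big_rec2 (fun p a => p = symbol a)); first by rewrite symbol0.
  by move=> t p a _ ->; rewrite symbolP.
have := congr1 (mcoeff (mlead (symbol (f j)))) sE; rewrite raddf_sum mcoeff0 (bigD1 j) //=.
rewrite big1 ?addr0 => [|t tj].
  rewrite mcoeffZ => /eqP; rewrite mulf_eq0 (negPf cj) mleadc_eq0 symbol_eq0 //.
  by rewrite (negPf (f0 j)).
have [->|ct] := eqVneq (c t) 0; first by rewrite scale0r mcoeff0.
rewrite mcoeffZ mcoeff_gt_mlead ?mulr0 // lt_neqAle; apply/andP; split; last exact: jmax.
by apply: contra tj => /eqP/linj->.
Qed.

Lemma products_mul (s : seq A) t t' a b :
  a \in products s t -> b \in products s t' -> a * b \in products s (t + t').
Proof.
elim: t a => [|t IH] a /=; first by rewrite inE => /eqP->; rewrite mul1r.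
move=> /allpairsP[[y z] /= [ys zt ->]] bt; rewrite -mulrA.
by apply/allpairsP; exists (y, z * b); split=> //; apply: IH.
Qed.

Lemma products_exp (s : seq A) t a : a \in s -> a ^+ t \in products s t.
Proof.
move=> ais; elim: t => [|t IH] /=; first by rewrite expr0 mem_head.
by rewrite exprS; apply/allpairsP; exists (a, a ^+ t).
Qed.

(* The exponents of [theta j] for [j != i0] (at [lshift n j]), of [theta i0] (at
   [rshift n i0]) and of [Q_i0^(w j) P_j^(w i0)] (at [rshift n j]). The value at
   [lshift n i0] is not used. *)
Definition generator_exponent (i : 'I_(n + n)) : multinom (n + n) :=
  match split i with
  | inl j => mnmx (mnm1 j) (mnm1 j)
  | inr j => if j == i0 then mnmx (mnm1 j) (mnm1 j)
             else mnmx (mnm_muln (mnm1 i0) (w j)) (mnm_muln (mnm1 j) (w i0))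
  end.
Local Notation gen := generator_exponent.

Lemma generator_balanced i : balanced w (gen i).
Proof.
rewrite /gen; case: (split i) => j; rewrite ?balancedE //.
by case: ifP => _; rewrite balancedE ?wt_mnm1n // mulnC.
Qed.

(** The system is triangular: for [j] other than [i0], coordinate [lshift n j] reads off
    [t (lshift n j)], and then coordinate [rshift n j] reads off [w i0 * t (rshift n j)]. *)
Lemma generator_exponents_free (t t' : 'I_(n + n) -> nat) :
  t (lshift n i0) = 0%N -> t' (lshift n i0) = 0%N ->
  (forall c, \sum_i gen i c * t i = \sum_i gen i c * t' i)%N -> t =1 t'.
Proof.
move=> t0 t0' E.
have gl j : gen (lshift n j) = mnmx (mnm1 j) (mnm1 j) by rewrite /gen split_lshift.
have gr j : gen (rshift n j) = if j == i0 then mnmx (mnm1 j) (mnm1 j)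
    else mnmx (mnm_muln (mnm1 i0) (w j)) (mnm_muln (mnm1 j) (w i0)).
  by rewrite /gen split_rshift.
have El u j : j != i0 -> (\sum_i gen i (lshift n j) * u i = u (lshift n j))%N.
  move=> ne; rewrite big_split_ord /= [X in (_ + X)%N]big1 => [|j' _].
    rewrite (bigD1 j) //= gl mnmx_lshift mnm1E eqxx mul1n big1 ?addn0 // => j' ne'.
    by rewrite gl mnmx_lshift mnm1E (negPf ne').
  rewrite gr; case: eqP => [->|_]; rewrite mnmx_lshift ?mulmnE mnm1E eq_sym (negPf ne) //.
have Er0 u : (\sum_i gen i (rshift n i0) * u i = u (lshift n i0) + u (rshift n i0))%N.
  rewrite big_split_ord /=; congr (_ + _)%N.
    rewrite (bigD1 i0) //= gl mnmx_rshift mnm1E eqxx mul1n big1 ?addn0 // => j' ne'.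
    by rewrite gl mnmx_rshift mnm1E (negPf ne').
  rewrite (bigD1 i0) //= gr eqxx mnmx_rshift mnm1E eqxx mul1n big1 ?addn0 // => j' ne'.
  by rewrite gr (negPf ne') mnmx_rshift mulmnE mnm1E (negPf ne').
have Er u j : j != i0 ->
    (\sum_i gen i (rshift n j) * u i = u (lshift n j) + w i0 * u (rshift n j))%N.
  move=> ne; rewrite big_split_ord /=; congr (_ + _)%N.
    rewrite (bigD1 j) //= gl mnmx_rshift mnm1E eqxx mul1n big1 ?addn0 // => j' ne'.
    by rewrite gl mnmx_rshift mnm1E (negPf ne').
  rewrite (bigD1 j) //= gr (negPf ne) mnmx_rshift mulmnE mnm1E eqxx mul1n big1 ?addn0 // => j' ne'.
  by rewrite gr; case: ifP => _; rewrite mnmx_rshift ?mulmnE mnm1E (negPf ne').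
have tl j : t (lshift n j) = t' (lshift n j).
  have [->|ne] := eqVneq j i0; first by rewrite t0 t0'.
  by have := E (lshift n j); rewrite !El.
move=> i; rewrite -(splitK i); case: (split i) => j //=.
have := E (rshift n j); have [->|ne] := eqVneq j i0.
  by rewrite !Er0 tl => /addnI.
by rewrite !Er // tl => /addnI /eqP; rewrite eqn_pmul2l // => /eqP.
Qed.

(** With [q] the quotient of [t] by [2 * n], the ordered products of generators with exponents at
    most [q] have at most [t] factors. There are [q.+1 ^ (2 * n - 1)] of them, with distinct leading
    exponents, and [t] is at most [2 * n * q.+1]. *)
Lemma dim_products_ge : exists s : seq A, forall t, (0 < t)%N ->
  (t ^ (2 * n - 1) <= (2 * n) ^ (2 * n - 1) * Defs.dim_span (products_upto s t))%N.
Proof.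
pose x i := mop (gen i); pose s := [seq x i | i <- enum 'I_(n + n)].
exists s => t t0; pose q := (t %/ (2 * n))%N.
pose X := {i : 'I_(n + n) | i != lshift n i0}.
have cX : #|{: X}| = (2 * n - 1)%N.
  rewrite card_sig (eq_card (B := predC1 (lshift n i0))) // cardC1 card_ord; lia.
pose J := {ffun X -> 'I_q.+1}.
have cJ : #|{: J}| = (q.+1 ^ (2 * n - 1))%N by rewrite card_ffun card_ord cX.
pose ext (u : J) (i : 'I_(n + n)) : nat := if insub i is Some y then val (u y) else 0%N.
have extle u i : (ext u i <= q)%N by rewrite /ext; case: insub => // y; rewrite -ltnS ltn_ord.
pose f (u : J) := \prod_i x i ^+ ext u i.
have x0 i : x i != 0.
  rewrite -(symbol_eq0 char0 iota_inj iota_image) symbol_monomial_op ?generator_balanced //.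
  by rewrite -msize_poly_eq0 msizeX.
have xe i e : x i ^+ e != 0 /\ forall c, mlead (symbol (x i ^+ e)) c = (gen i c * e)%N.
  elim: e => [|e [xe0 xeE]].
    by rewrite expr0 oner_neq0 symbol1 // mlead1; split=> // c; rewrite mnm0E muln0.
  rewrite exprS; have [-> ->] := lead_mul (x0 i) xe0; split=> // c.
  by rewrite mnmDE xeE symbol_monomial_op ?generator_balanced // mleadXm mulnS.
have fP (u : J) (r : seq 'I_(n + n)) : \prod_(i <- r) x i ^+ ext u i != 0 /\
    forall c, mlead (symbol (\prod_(i <- r) x i ^+ ext u i)) c = (\sum_(i <- r) gen i c * ext u i)%N.
  elim: r => [|i r [IH0 IH]].
    by rewrite big_nil oner_neq0 symbol1 // mlead1; split=> // c; rewrite big_nil mnm0E.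
  rewrite big_cons; have [e0 eE] := xe i (ext u i); have [-> ->] := lead_mul e0 IH0.
  by split=> // c; rewrite mnmDE eE IH big_cons.
have fs (u : J) (r : seq 'I_(n + n)) :
    \prod_(i <- r) x i ^+ ext u i \in products s (\sum_(i <- r) ext u i)%N.
  elim: r => [|i r IH]; first by rewrite !big_nil mem_head.
  rewrite !big_cons; apply: products_mul => //; apply: products_exp.
  by apply: map_f; rewrite mem_enum.
have n2 : (0 < 2 * n)%N by case: (n) (i0) => [[]|] //.
have dimge : (q.+1 ^ (2 * n - 1) <= Defs.dim_span (products_upto s t))%N.
  rewrite -cJ; apply: (@dim_span_ge k A _ _ f) => [u|].
    apply/flattenP; exists (products s (\sum_i ext u i)%N); last exact: fs.
    apply: map_f; rewrite mem_iota add0n ltnS /=.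
    apply: (@leq_trans (\sum_(i < n + n) q)%N); first by apply: leq_sum => i _; exact: extle.
    rewrite sum_nat_const card_ord; apply: leq_trans (leq_trunc_div t (2 * n)).
    by rewrite mulnC -/q leq_mul2l; apply/orP; right; lia.
  apply: free_of_leads => [u|u u' E]; first by case: (fP u (index_enum _)).
  have ext0 v : ext v (lshift n i0) = 0%N by rewrite /ext insubF // eqxx.
  have H : ext u =1 ext u'.
    apply: generator_exponents_free => // c.
    have [_ <-] := fP u (index_enum _); have [_ <-] := fP u' (index_enum _).
    by rewrite -!/(f _) E.
  by apply/ffunP => y; apply: val_inj; have := H (val y); rewrite /ext valK.
apply: leq_trans (leq_mul (leqnn _) dimge); rewrite -expnMn.
have le : (t <= 2 * n * q.+1)%N by rewrite mulnC ltnW // ltn_ceil.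
by case: (2 * n - 1)%N => // N; rewrite leq_exp2r.
Qed.

Lemma balanced_GKdim (R : realType) : GKdim R A = ((2 * n - 1)%N%:R)%:E.
Proof.
apply/eqP; rewrite eq_le; apply/andP; split.
  apply: ge_ereal_sup => _ [s _ <-]; have [C HC] := dim_products_le s.
  exact: limn_esup_growth_le HC.
have [s Hs] := dim_products_ge; apply: le_ereal_sup_tmp.
eexists; first by exists s.
apply: limn_esup_growth_ge Hs; rewrite expn_gt0; apply/orP; left.
by case: (n) (i0) => [[]|].
Qed.

End GKdimension.

Theorem mainTheorem5 (k : closedFieldType) (char0 : [pchar k] =i pred0)
    (R : realType) :
  (forall (n : nat) (b : 'I_n -> int),
     (2 <= n)%N -> (forall i, b i != 0) ->
     [/\ noetherian (invariants (torus_act k b)),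
         FCR_algebra (invariants (torus_act k b))
       & GKdim R (invariants (torus_act k b)) = ((2 * n - 1)%N%:R)%:E])
  /\
  (forall d : nat, odd d -> (3 <= d)%N ->
     exists A : algType k,
       [/\ noetherian A, FCR_algebra A & GKdim R A = (d%:R)%:E]).
Proof.
have main n (b : 'I_n -> int) : (2 <= n)%N -> (forall i, b i != 0) ->
    [/\ noetherian (invariants (torus_act k b)),
        FCR_algebra (invariants (torus_act k b))
      & GKdim R (invariants (torus_act k b)) = ((2 * n - 1)%N%:R)%:E].
  move=> n2 b0; have w_gt0 i : (0 < `|b i|)%N by rewrite absz_gt0.
  have inj := @invariant_operator_inj k n b char0.
  have image := @invariant_operator_image k n b char0 b0.
  split; first exact: (balanced_noetherian char0 inj image).
    split; first exact: (balanced_enough_finite_dimensional w_gt0 inj image).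
    by move=> M fdM; apply: (balanced_completely_reducible char0 w_gt0 n2 inj image fdM).
  exact: (balanced_GKdim char0 w_gt0 inj image (Ordinal (ltnW n2))).
(* For odd [d] this choice gives [2 * n - 1 = d]; all weights are taken to be 1. *)
split=> // d d_odd d_ge3; pose n := d.+1./2.
have n2 : (2 <= n)%N by rewrite /n; lia.
have [noeth fcr gk] := main n (fun=> 1) n2 (fun=> isT).
exists (invariants (torus_act k (fun _ : 'I_n => 1))); split=> //.
by rewrite gk; congr (_%:R)%:E; rewrite /n; lia.
Qed.
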